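(* Let $\epsilon'=\epsilon/(6c_\infty-\eta\iota)$, $$\gamma_1=\min\Big\{\frac{1}{(2c_\infty-\eta\iota)^2},\ \frac{2(2\theta-\theta^2)}{(7-5\theta)^2c_\infty^2},\ \frac{1}{49c_\infty^2}\Big\}$$ (so $\gamma_1=O(c_\infty^{-2})$), and, with $s=\epsilon$, $$T=8+\frac{48}{\eta\sqrt{\gamma_1}\,\epsilon'}+\frac{\big(3600(1-\theta)^2+882\big)c_\infty^2\,s}{\eta\epsilon^2}+\frac{48}{\eta\gamma_1\epsilon}=O\big(c_\infty^2\epsilon^{-2}\big).$$ Then at least one of the iterations of PAME within the first $T$, after rounding, is an $\epsilon$-saddle point (that is, an $\epsilon$-optimal solution) of the EOT problem. Here the rounding of iteration $S\ge1$ is the pair $(\hat{\pmb\pi},\hat\lambda)$ given by $(a^k,b^k)_{k\in[N]}=\mathrm{Margins}(\pmb\pi(f^S,g^{S-1},\lambda^{S-1}),a,b)$, $\hat\pi^k=\mathrm{Round}(\pi^k(f^S,g^{S-1},\lambda^{S-1}),a^k,b^k)$ for $k\in[N]$, and $\hat\lambda=\lambda^{S-1}$.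
   Context: $\Delta^m$ is the probability simplex in $\mathbb{R}^m$; $[N]=\{1,\dots,N\}$. Let $n,N\ge1$, $\epsilon>0$, $\theta\in(0,1)$, $a,b\in\Delta^n$ with $b_i>0$ for all $i$, and let $C^1,\dots,C^N\in\mathbb{R}^{n\times n}$ be cost matrices. Put $\|C\|_\infty=\max_{i,j}|C_{ij}|$, $c_\infty=\max_k\|C^k\|_\infty$, $\iota=\min_j\log b_j$. For a matrix $\pi$, $r(\pi)=\pi\mathbf 1$, $c(\pi)=\pi^\top\mathbf 1$ are its row and column sums, $\|\pi\|_1$ is the entrywise $\ell_1$ norm. EOT (equitable and optimal transport) problem: let $\Pi^N_{a,b}$ be the set of $\pmb\pi=(\pi^k)_{k\in[N]}$ with $\pi^k\in\mathbb{R}_{\ge0}^{n\times n}$, $r(\sum_k\pi^k)=a$, $c(\sum_k\pi^k)=b$, and $\ell(\pmb\pi,\lambda)=\sum_{k=1}^N\lambda_k\langle\pi^k,C^k\rangle$; the problem is $\min_{\pmb\pi\in\Pi^N_{a,b}}\max_{\lambda\in\Delta^N}\ell(\pmb\pi,\lambda)$. A pair $(\hat{\pmb\pi},\hat\lambda)\in\Pi^N_{a,b}\times\Delta^N$ is an $\epsilon$-optimal solution if $\max_{\lambda\in\Delta^N}\ell(\hat{\pmb\pi},\lambda)-\min_{\pmb\pi\in\Pi^N_{a,b}}\ell(\pmb\pi,\hat\lambda)\le\epsilon$. PAME (Projected Alternating Maximization with Extrapolation): let $$\eta=\min\Big\{\frac{\epsilon}{3(\log(n^2N)+1)},\,c_\infty\Big\},\qquad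 \tau=\frac{\eta}{2c_\infty^2} .$$ Let $\zeta^k(f,g,\lambda)$ be the matrix with entries $\exp((f_i+g_j-\lambda_kC^k_{ij})/\eta)$, $\pi^k(f,g,\lambda)=\zeta^k(f,g,\lambda)/\sum_{l=1}^N\|\zeta^l(f,g,\lambda)\|_1$, $\pmb\pi(f,g,\lambda)=(\pi^k(f,g,\lambda))_{k\in[N]}$, and $$F(f,g,\lambda)=\langle f,a\rangle+\langle g,b\rangle-\eta\log\Big(\sum_{k=1}^N\|\zeta^k(f,g,\lambda)\|_1\Big)-\eta .$$ Let $(f^*,g^*,\lambda^* )$ be a maximizer of $F$ over $\mathbb{R}^n\times\mathbb{R}^n\times\Delta^N$ and $\tilde F(f,g,\lambda)=F(f^*,g^*,\lambda^* )-F(f,g,\lambda)$. PAME starts from $f^0=g^0=(1,\dots,1)^\top$, $\lambda^{-1}=\lambda^0=(1/N,\dots,1/N)^\top$ and iterates (log and division entrywise) $$f^{t+1}=f^t+\eta\log\frac{a}{r(\sum_k\zeta^k(f^t,g^t,\lambda^t))},\quad g^{t+1}=g^t+\eta\log\frac{b}{c(\sum_k\zeta^k(f^{t+1},g^t,\lambda^t))},$$ $$y^{t+1}=\mathrm{Proj}_{\Delta^N}\big(\lambda^t+(1-\theta)(\lambda^t-\lambda^{t-1})\big),\quad \lambda^{t+1}=\mathrm{Proj}_{\Delta^N}\big(y^{t+1}+\tau\nabla_\lambda F(f^{t+1},g^{t+1},y^{t+1})\big),$$ with $\mathrm{Proj}_{\Delta^N}$ the Euclidean projection onto $\Delta^N$.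 Put $c^t:=c\big(\sum_k\pi^k(f^{t+1},g^t,\lambda^t)\big)$. PAME stops at the first iteration $S\ge1$ at which $\|c^{S-1}-b\|_1\le\frac{\epsilon}{6(6c_\infty-\eta\iota)}$, $\|\lambda^{S-1}-\lambda^{S-2}\|_2\le\frac{\eta\epsilon}{60(1-\theta)c_\infty^2}$, $\|\lambda^S-y^S\|_2\le\frac{\eta\epsilon}{42c_\infty^2}$ and $\tilde F(f^S,g^{S-1},\lambda^{S-1})\le\frac{\epsilon}{6}$ all hold. Margins: given $\pmb\pi$ with $r(\sum_k\pi^k)=a$, $\mathrm{Margins}(\pmb\pi,a,b)$ returns $a^k=r(\pi^k)$ and vectors $b^k\in\mathbb{R}^n$ such that (i) $b^k\ge0$; (ii) $\sum_kb^k=b$; (iii) $\sum_ia^k_i=\sum_jb^k_j$ for all $k$; (iv) for each fixed $j$, $(b^k_j-[c(\pi^k)]_j)(b^{k'}_j-[c(\pi^{k'})]_j)\ge0$ for all $k,k'$. They are built by starting from $b^k=c(\pi^k)+\frac1N\big(b-c(\sum_l\pi^l)\big)$ and, as long as some $b^k_j<0$, picking $j'$ with $b^k_{j'}>[c(\pi^k)]_{j'}$ and $k'$ with $b^{k'}_j>0$, and, with $\vartheta=\min\{|b^k_j|,|b^{k'}_j|,|b^k_{j'}-[c(\pi^k)]_{j'}|\}$, adding $\vartheta$ to $b^k_j$ and $b^{k'}_{j'}$ and subtracting $\vartheta$ from $b^k_{j'}$ and $b^{k'}_j$. $\mathrm{Round}(\pi,a,b)$ for $\pi\in\mathbb{R}^{n\times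 n}$, $a,b\in\mathbb{R}^n_+$: $\pi'=\mathrm{Diag}(x)\pi$ with $x_i=\min\{a_i/r(\pi)_i,1\}$; $\pi''=\pi'\,\mathrm{Diag}(y)$ with $y_j=\min\{b_j/c(\pi')_j,1\}$; $e_a=a-r(\pi'')$, $e_b=b-c(\pi'')$; output $\pi''+e_ae_b^\top/\|e_a\|_1$. *)

(* Defs.v *)
From mathcomp Require Import all_boot all_order all_algebra.
From mathcomp Require Import all_classical all_reals all_analysis.

Set Implicit Arguments.
Unset Strict Implicit.
Unset Printing Implicit Defensive.

Import Order.TTheory GRing.Theory Num.Theory.
Import numFieldNormedType.Exports.
Local Open Scope classical_set_scope.
Local Open Scope ring_scope.

Section LinearAlgebra.
Context {R : realType}.

Definition simplex (m : nat) : set 'cV[R]_m :=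
  [set x | (forall i, 0 <= x i 0) /\ \sum_i x i 0 = 1].

Definition rsum (m n : nat) (P : 'M[R]_(m, n)) : 'cV[R]_m := P *m const_mx 1.
Definition csum (m n : nat) (P : 'M[R]_(m, n)) : 'cV[R]_n := P^T *m const_mx 1.

Definition inner (m n : nat) (P Q : 'M[R]_(m, n)) : R :=
  \sum_i \sum_j P i j * Q i j.

Definition l1norm (m n : nat) (P : 'M[R]_(m, n)) : R :=
  \sum_i \sum_j `|P i j|.

Definition l2norm (m : nat) (x : 'cV[R]_m) : R :=
  Num.sqrt (\sum_i x i 0 ^+ 2).

Definition gradient (m : nat) (h : 'cV[R]_m -> R) (x : 'cV[R]_m) : 'cV[R]_m :=
  \col_k 'D_(delta_mx k 0) h x.

(* The nearest point of the simplex exists and is unique as soon as 0 < m;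
   the default value 0 of xget is then never used. *)
Definition proj_simplex (m : nat) (v : 'cV[R]_m) : 'cV[R]_m :=
  xget 0 [set x | simplex x /\
                  forall z, simplex z -> l2norm (v - x) <= l2norm (v - z)].

End LinearAlgebra.

Section EOT.
Context {R : realType} {n N : nat}.
Variables (a b : 'cV[R]_n) (C : 'I_N -> 'M[R]_n).

(* All the entries are nonnegative, so that starting the maximum at 0 is
   harmless. *)
Definition cinf : R :=
  \big[Num.max/0]_(k < N) \big[Num.max/0]_(i < n) \big[Num.max/0]_(j < n)
    `|C k i j|.

(* For b in the simplex every ln (b j 0) is nonpositive, so that starting the
   minimum at 0 is harmless. *)
Definition iota_b : R := \big[Num.min/0]_(j < n) ln (b j 0).

Definition couplings : set ('I_N -> 'M[R]_n) :=
  [set P : 'I_N -> 'M[R]_n | [/\ forall k i j, 0 <= P k i j,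
               rsum (\sum_k P k) = a
             & csum (\sum_k P k) = b]].

Definition ell (P : 'I_N -> 'M[R]_n) (lam : 'cV[R]_N) : R :=
  \sum_k lam k 0 * inner (P k) (C k).

(* ell is continuous and both feasible sets are compact and nonempty, so that
   the supremum and the infimum are the maximum and the minimum. *)
Definition eps_optimal (eps : R) (P : 'I_N -> 'M[R]_n) (lam : 'cV[R]_N) : Prop :=
  [/\ couplings P, simplex lam
    & sup [set ell P mu | mu in @simplex R N]
      - inf [set ell Q lam | Q in couplings] <= eps].

End EOT.

Section PAME.
Context {R : realType} {n N : nat}.
Variables (eps theta : R) (a b : 'cV[R]_n) (C : 'I_N -> 'M[R]_n).

Definition eta : R :=
  Num.min (eps / (3 * (ln (n ^ 2 * N)%:R + 1))) (cinf C).

Definition tau : R := eta / (2 * cinf C ^+ 2).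

Definition zeta (f g : 'cV[R]_n) (lam : 'cV[R]_N) (k : 'I_N) : 'M[R]_n :=
  \matrix_(i, j) expR ((f i 0 + g j 0 - lam k 0 * C k i j) / eta).

Definition gibbs (f g : 'cV[R]_n) (lam : 'cV[R]_N) (k : 'I_N) : 'M[R]_n :=
  (\sum_l l1norm (zeta f g lam l))^-1 *: zeta f g lam k.

Definition dualF (f g : 'cV[R]_n) (lam : 'cV[R]_N) : R :=
  inner f a + inner g b - eta * ln (\sum_k l1norm (zeta f g lam k)) - eta.

Definition dual_maximizer (fs gs : 'cV[R]_n) (ls : 'cV[R]_N) : Prop :=
  simplex ls /\
  forall f g lam, simplex lam -> dualF f g lam <= dualF fs gs ls.

(* The state after t iterations: f^t, g^t, lambda^t and lambda^(t-1). *)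
Record pame_state := PameState {
  st_f : 'cV[R]_n;
  st_g : 'cV[R]_n;
  st_lam : 'cV[R]_N;
  st_lam_prev : 'cV[R]_N }.

Definition pame_init : pame_state :=
  PameState (const_mx 1) (const_mx 1) (const_mx N%:R^-1) (const_mx N%:R^-1).

(* From the state after t iterations, extrapolate computes y^(t+1). *)
Definition extrapolate (s : pame_state) : 'cV[R]_N :=
  proj_simplex (st_lam s + (1 - theta) *: (st_lam s - st_lam_prev s)).

Definition pame_step (s : pame_state) : pame_state :=
  let f := \col_i (st_f s i 0
    + eta * ln (a i 0
                / rsum (\sum_k zeta (st_f s) (st_g s) (st_lam s) k) i 0)) in
  let g := \col_j (st_g s j 0
    + eta * ln (b j 0 / csum (\sum_k zeta f (st_g s) (st_lam s) k) j 0)) in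
  let y := extrapolate s in
  let lam := proj_simplex (y + tau *: gradient (dualF f g) y) in
  PameState f g lam (st_lam s).

Definition pame (t : nat) : pame_state := iter t pame_step pame_init.

Definition pame_f t := st_f (pame t).
Definition pame_g t := st_g (pame t).
Definition pame_lam t := st_lam (pame t).

(* pi(f^S, g^(S-1), lambda^(S-1)), for S >= 1. *)
Definition pame_plan (S : nat) : 'I_N -> 'M[R]_n :=
  gibbs (pame_f S) (pame_g S.-1) (pame_lam S.-1).

(* (fs, gs, ls) stands for a maximizer of dualF. The conditions are meaningful
   for S >= 1 only: lambda^(S-2) is the previous multiplier stored in the state
   after S-1 iterations, and y^S is extrapolated from that state. *)
Definition stop_test (fs gs : 'cV[R]_n) (ls : 'cV[R]_N) (S : nat) : Prop :=
  [/\ l1norm (csum (\sum_k pame_plan S k) - b)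
        <= eps / (6 * (6 * cinf C - eta * iota_b b)),
      l2norm (pame_lam S.-1 - st_lam_prev (pame S.-1))
        <= eta * eps / (60 * (1 - theta) * cinf C ^+ 2),
      l2norm (pame_lam S - extrapolate (pame S.-1))
        <= eta * eps / (42 * cinf C ^+ 2)
    & dualF fs gs ls - dualF (pame_f S) (pame_g S.-1) (pame_lam S.-1)
        <= eps / 6].

(* S is an iteration that PAME actually performs: S >= 1 and PAME has not
   stopped at an earlier iteration. *)
Definition pame_performs (fs gs : 'cV[R]_n) (ls : 'cV[R]_N) (S : nat) : Prop :=
  (1 <= S)%N /\
  forall S' : nat, (1 <= S' < S)%N -> ~ stop_test fs gs ls S'.

Definition eps' : R := eps / (6 * cinf C - eta * iota_b b).

Definition gamma1 : R :=
  Num.min (1 / (2 * cinf C - eta * iota_b b) ^+ 2)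
    (Num.min (2 * (2 * theta - theta ^+ 2)
                / ((7 - 5 * theta) ^+ 2 * cinf C ^+ 2))
             (1 / (49 * cinf C ^+ 2))).

Definition iter_bound (s : R) : R :=
  8 + 48 / (eta * Num.sqrt gamma1 * eps')
  + (3600 * (1 - theta) ^+ 2 + 882) * cinf C ^+ 2 * s / (eta * eps ^+ 2)
  + 48 / (eta * gamma1 * eps).

End PAME.

Section Rounding.
Context {R : realType} {n N : nat}.

Definition margins_init (P : 'I_N -> 'M[R]_n) (b : 'cV[R]_n) :
    'I_N -> 'cV[R]_n :=
  fun k => csum (P k) + N%:R^-1 *: (b - csum (\sum_l P l)).

(* One pass of the loop, with arbitrary admissible choices of k, j, k', j':
   the margins of indices k and k' exchange the amount vt in columns j and j'. *)
Definition margins_step (P : 'I_N -> 'M[R]_n) (B B' : 'I_N -> 'cV[R]_n) : Prop :=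
  exists (k k' : 'I_N) (j j' : 'I_n),
    [/\ B k j 0 < 0, csum (P k) j' 0 < B k j' 0, 0 < B k' j 0
      & let vt := Num.min `|B k j 0|
                    (Num.min `|B k' j 0| `|B k j' 0 - csum (P k) j' 0|) in
        B' = fun l => B l
          + (vt * (l == k)%:R) *: (delta_mx j 0 - delta_mx j' 0)
          + (vt * (l == k')%:R) *: (delta_mx j' 0 - delta_mx j 0)].

Inductive margins_reach (P : 'I_N -> 'M[R]_n) (b : 'cV[R]_n) :
    ('I_N -> 'cV[R]_n) -> Prop :=
| margins_start : margins_reach P b (margins_init P b)
| margins_next B B' :
    margins_reach P b B -> margins_step P B B' -> margins_reach P b B'.

(* B is a possible result (b^k)_k of the procedure: the loop is left when no
   entry is negative. The companion margins a^k are the row sums of P k. *)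
Definition margins (P : 'I_N -> 'M[R]_n) (b : 'cV[R]_n)
    (B : 'I_N -> 'cV[R]_n) : Prop :=
  margins_reach P b B /\ forall k j, 0 <= B k j 0.

(* When e_a = 0 the last term is 0 (as x / 0 = 0), and the result is P2. *)
Definition round_plan (P : 'M[R]_n) (a b : 'cV[R]_n) : 'M[R]_n :=
  let x := \col_i Num.min (a i 0 / rsum P i 0) 1 in
  let P1 := diag_mx x^T *m P in
  let y := \col_j Num.min (b j 0 / csum P1 j 0) 1 in
  let P2 := P1 *m diag_mx y^T in
  let ea := a - rsum P2 in
  let eb := b - csum P2 in
  P2 + (l1norm ea)^-1 *: (ea *m eb^T).

(* The choices inside the margin procedure are not determined: some run of it
   returns, and whatever is returned, the rounded pair is eps-optimal. *)
Definition rounded_eps_optimal (eps : R) (a b : 'cV[R]_n)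
    (C : 'I_N -> 'M[R]_n) (P : 'I_N -> 'M[R]_n) (lam : 'cV[R]_N) : Prop :=
  (exists B, margins P b B) /\
  forall B, margins P b B ->
    eps_optimal a b C eps (fun k => round_plan (P k) (rsum (P k)) (B k)) lam.

End Rounding.

(* Main.v *)
(* Proof idea. With f = f^(t+1), g = g^t, lambda = lambda^t the Gibbs plan has the
   exact row sums a. The dual objective is a linear function minus eta times a
   log-sum-exp, and the Bregman divergence of log-sum-exp is a Kullback-Leibler
   divergence, so Pinsker's inequality yields at once the concavity of the dual
   objective, the smoothness of its lambda-gradient (constant L = c^2 / eta) and
   the gain of a column update. Put x = |c^t - b|_1, u = |lambda^t - lambda^(t-1)|_2
   and v = |lambda^(t+1) - y^(t+1)|_2. The potential
     G_t = max F - F(f^(t+1), g^t, lambda^t) + L u^2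
   decreases by D_t = eta/2 x^2 + L (2 theta - theta^2) u^2 + L/2 v^2, while
   concavity at (f^(t+1), g^t, lambda^t) bounds G_t linearly by x, u and v. Hence
   G_t^2 <= O(1 / (eta gamma1)) D_t, so that G falls below eps / 6 at the rate
   1 / t; from then on every iteration at which x, u or v is large consumes a
   fixed share of what remains. When x, u and v are small, the rounding moves the
   plan by at most x in l1-norm, and weak duality together with the entropy
   bound ln(n^2 N) gives the saddle-point gap. *)

Require Import Defs.
From mathcomp Require Import all_boot all_order all_algebra.
From mathcomp Require Import all_classical all_reals all_analysis.
From mathcomp Require Import ring lra.

Set Implicit Arguments.
Unset Strict Implicit.
Unset Printing Implicit Defensive.

Import Order.TTheory GRing.Theory Num.Theory.
Import numFieldNormedType.Exports.
Local Open Scope ring_scope.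

(** * Pinsker's inequality, log-sum-exp and its gradient *)

Section Entropy.
Local Open Scope classical_set_scope.
Context {R : realType}.

(** The difference of the two sides has derivative (y - 1)^3 / (y^2 (y + 2)^2), so its minimum is
    the value 0 at y = 1. The rational function is such that x times it, minus x - 1, equals 3/2 (x
    - 1)^2 / (x + 2), the form summed in Pinsker's inequality. *)
Lemma ln_ge_pade (x : R) : 0 < x ->
  (x - 1) * (5 * x + 1) / (2 * x * (x + 2)) <= ln x.
Proof.
move=> x0.
pose h (y : R) := ln y - (y - 1) * (5 * y + 1) / (2 * y * (y + 2)).
pose dh (y : R) := (y - 1) ^+ 3 / (y ^+ 2 * (y + 2) ^+ 2).
have Dh (y : R) : 0 < y -> is_derive y 1 h (dh y).
  move=> y0.
  have y2 : y + 2 != 0 by rewrite gt_eqF// addr_gt0.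
  have yn0 : y != 0 by rewrite gt_eqF.
  have hh : 2 * y * (y + 2) != 0 by rewrite !mulf_neq0.
  rewrite /h.
  have := is_derive1_ln y0 => Hln.
  have Hinv : is_derive y 1 (fun y : R => (2 * y * (y + 2))^-1)
      (- (2 * y * (y + 2)) ^- 2 *: (4 * y + 4)).
    apply: is_deriveV => //.
    apply: is_derive_eq.
    rewrite /GRing.scale /=; ring.
  apply: is_derive_eq.
  rewrite /dh /GRing.scale /=; field.
  by rewrite y2 yn0.
have h1 : h 1 = 0 by rewrite /h ln1 subrr !mul0r subrr.
have ch (u v : R) : 0 < u -> {within `[u, v], continuous h}.
  move=> u0; apply: continuous_in_subspaceT => y; rewrite inE/= in_itv/= => /andP[uy _].
  have := Dh y (lt_le_trans u0 uy) => -[? _].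
  by apply/differentiable_continuous/derivable1_diffP.
rewrite -subr_ge0 -/(h x); have -> : h x = h x - h 1 by rewrite h1 subr0.
have dhpos (y : R) : 0 < y -> 0 < y ^+ 2 * (y + 2) ^+ 2.
  by move=> y0; rewrite mulr_gt0// exprn_gt0// addr_gt0.
have [x1|x1] := leP x 1.
  have [|c] := MVT_segment x1 (df := dh) _ (ch _ _ x0).
    by move=> y; rewrite in_itv/= => /andP[xy _]; exact/Dh/(lt_trans x0).
  rewrite in_itv/= => /andP[xc c1] eqc.
  rewrite -[X in 0 <= X]opprB eqc oppr_ge0 mulr_le0_ge0 ?subr_ge0//.
  have cp : 0 < c by exact: lt_le_trans xc.
  rewrite /dh ler_pdivrMr ?dhpos// mul0r.
  by rewrite real_exprn_odd_le0 ?num_real// subr_le0.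
have [|c] := MVT_segment (ltW x1) (df := dh) _ (ch _ _ ltr01).
  by move=> y; rewrite in_itv/= => /andP[xy _]; exact/Dh/(lt_trans ltr01).
rewrite in_itv/= => /andP[c1 cx] ->.
rewrite mulr_ge0 ?subr_ge0 ?(ltW x1)// /dh divr_ge0 ?exprn_ge0 ?subr_ge0//.
by rewrite ltW ?dhpos ?(lt_le_trans ltr01).
Qed.

(* The parameter s linearizes (p - q)^2 / (p + 2 q), so that the bounds can be
   summed; the best choice is s = |p - q|_1 / 3. *)
Lemma kl_term_ge (p q s : R) : 0 < p -> 0 < q ->
  3 / 2 * (2 * s * `|p - q| - s ^+ 2 * (p + 2 * q)) <= p * ln (p / q) - p + q.
Proof.
move=> p0 q0.
have pq0 : 0 < p + 2 * q by rewrite addr_gt0// mulr_gt0.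
have /(ler_wpM2l (ltW p0)) := ln_ge_pade (divr_gt0 p0 q0).
set l := ln _ => H.
have {H} : 3 / 2 * ((p - q) ^+ 2 / (p + 2 * q)) <= p * l - p + q.
  rewrite -lerBlDr lerBrDr; apply: le_trans H.
  rewrite le_eqVlt; apply/orP; left; apply/eqP.
  by field; rewrite !gt_eqF.
apply: le_trans; rewrite ler_pM2l ?divr_gt0//.
rewrite ler_pdivlMr// -subr_ge0 -[(p - q) ^+ 2]real_normK ?num_real//.
set d := `| _ |.
suff -> : d ^+ 2 - (2 * s * d - s ^+ 2 * (p + 2 * q)) * (p + 2 * q)
   = (d - s * (p + 2 * q)) ^+ 2 by exact: sqr_ge0.
ring.
Qed.

Lemma pinsker (I : finType) (p q : I -> R) :
  (forall i, 0 < p i) -> (forall i, 0 < q i) ->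
  \sum_i p i = 1 -> \sum_i q i = 1 ->
  (\sum_i `|p i - q i|) ^+ 2 / 2 <= \sum_i p i * ln (p i / q i).
Proof.
move=> p0 q0 p1 q1; set t := \sum_i `| _ |.
have -> : \sum_i p i * ln (p i / q i)
    = \sum_i (p i * ln (p i / q i) - p i + q i).
  by rewrite big_split/= sumrB p1 q1 subrK.
(* The weights [p i + 2 * q i] sum to 3, so s = t / 3 makes the summed lower bound exactly t^2 /
   2. *)
have -> : t ^+ 2 / 2 = \sum_i 3 / 2 *
    (2 * (t / 3) * `|p i - q i| - (t / 3) ^+ 2 * (p i + 2 * q i)).
  rewrite -mulr_sumr sumrB -!mulr_sumr -/t big_split/= -mulr_sumr p1 q1.
  by field.
by apply: ler_sum => i _; exact: kl_term_ge.
Qed.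

Definition lse (I : finType) (s : I -> R) : R := ln (\sum_i expR (s i)).

Definition softmax (I : finType) (s : I -> R) (i : I) : R :=
  expR (s i) / \sum_j expR (s j).

Section Softmax.
Variables (I : finType) (i0 : I).
Implicit Types s : I -> R.

Lemma sum_expR_gt0 s : 0 < \sum_i expR (s i).
Proof.
by rewrite (bigD1 i0)//= ltr_pwDl ?expR_gt0// sumr_ge0// => i _; rewrite expR_ge0.
Qed.

Lemma softmax_gt0 s i : 0 < softmax s i.
Proof. by rewrite divr_gt0 ?expR_gt0 ?sum_expR_gt0. Qed.

Lemma sum_softmax s : \sum_i softmax s i = 1.
Proof. by rewrite -mulr_suml divff// gt_eqF ?sum_expR_gt0. Qed.

(** Since ln (softmax r i) = r i - lse r, the right-hand side is the Kullback-Leibler divergence of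
    [softmax s] from [softmax s'], and Pinsker's inequality applies. *)
Lemma lse_bregman_ge s s' :
  (\sum_i `|softmax s' i - softmax s i|) ^+ 2 / 2
    <= lse s' - lse s - \sum_i softmax s i * (s' i - s i).
Proof.
have := pinsker (softmax_gt0 s) (softmax_gt0 s') (sum_softmax s) (sum_softmax s').
under eq_bigr do rewrite distrC.
move/le_trans; apply.
have lnsm (r : I -> R) i : ln (softmax r i) = r i - lse r.
  by rewrite /softmax ln_div ?posrE ?expR_gt0 ?sum_expR_gt0// expRK.
under eq_bigr do rewrite ln_div ?posrE ?softmax_gt0// !lnsm.
rewrite (eq_bigr (fun i => softmax s i * (lse s' - lse s)
   - softmax s i * (s' i - s i))).
  by rewrite sumrB -mulr_suml sum_softmax mul1r.
by move=> i _; ring.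
Qed.

(** Adding [lse_bregman_ge] in both directions bounds t^2, for the l1-distance t, by the pairing of
    the two differences, which is at most t D; then t cancels. *)
Lemma softmax_lipschitz s s' (D : R) : (forall i, `|s' i - s i| <= D) ->
  \sum_i `|softmax s' i - softmax s i| <= D.
Proof.
move=> sD; set t := \sum_i _.
have t0 : 0 <= t by apply: sumr_ge0.
have h1 := lse_bregman_ge s s'; rewrite -/t in h1.
have h2 := lse_bregman_ge s' s.
have tE : \sum_i `|softmax s i - softmax s' i| = t.
  by apply: eq_bigr => i _; rewrite distrC.
rewrite tE in h2.
have h3 : \sum_i (softmax s' i - softmax s i) * (s' i - s i) <= t * D.
  rewrite /t mulr_suml; apply: ler_sum => i _.
  by rewrite (le_trans (ler_norm _))// normrM ler_wpM2l.
have h4 : \sum_i (softmax s' i - softmax s i) * (s' i - s i) =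
    - \sum_i softmax s' i * (s i - s' i) - \sum_i softmax s i * (s' i - s i).
  by rewrite -sumrN -sumrB; apply: eq_bigr => i _; ring.
(* The case t = 0 only asks for D >= 0, which the bound at the index [i0] provides. *)
have [->|tn0] := eqVneq t 0; first exact: le_trans (sD i0).
have tp : 0 < t by rewrite lt_neqAle eq_sym tn0.
rewrite -(ler_pM2l tp); lra.
Qed.

(* Hoeffding's lemma, with t the l1-distance of the two Gibbs measures: the
   symmetrized divergence is at most t D, and by Pinsker the divergence in the
   other direction is at least t^2 / 2, which leaves t D - t^2 / 2 <= D^2 / 2. *)
Lemma lse_smooth s s' (D : R) : (forall i, `|s' i - s i| <= D) ->
  lse s' - lse s - \sum_i softmax s i * (s' i - s i) <= D ^+ 2 / 2.
Proof.
move=> sD; set t := \sum_i `|softmax s' i - softmax s i|.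
have h2 := lse_bregman_ge s' s.
have tE : \sum_i `|softmax s i - softmax s' i| = t.
  by apply: eq_bigr => i _; rewrite distrC.
rewrite tE in h2.
have h3 : \sum_i (softmax s' i - softmax s i) * (s' i - s i) <= t * D.
  rewrite /t mulr_suml; apply: ler_sum => i _.
  by rewrite (le_trans (ler_norm _))// normrM ler_wpM2l.
have h4 : \sum_i (softmax s' i - softmax s i) * (s' i - s i) =
    - \sum_i softmax s' i * (s i - s' i) - \sum_i softmax s i * (s' i - s i).
  by rewrite -sumrN -sumrB; apply: eq_bigr => i _; ring.
have := sqr_ge0 (t - D).
nra.
Qed.

End Softmax.

End Entropy.

(** * Euclidean projection onto the simplex *)

Section Projection.
Context {R : realType} {m : nat}.
Implicit Types v x y z : 'cV[R]_m.
Local Open Scope classical_set_scope.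

Lemma l2norm_ge0 x : 0 <= l2norm x.
Proof. exact: sqrtr_ge0. Qed.

Lemma sqr_l2norm x : l2norm x ^+ 2 = \sum_i x i 0 ^+ 2.
Proof. by rewrite sqr_sqrtr// sumr_ge0// => i _; exact: sqr_ge0. Qed.

Lemma ler_l2norm x y :
  (l2norm x <= l2norm y) = (\sum_i x i 0 ^+ 2 <= \sum_i y i 0 ^+ 2).
Proof. by rewrite /l2norm ler_sqrt// sumr_ge0// => i _; exact: sqr_ge0. Qed.

Lemma entry_le_l2norm x i : `|x i 0| <= l2norm x.
Proof.
rewrite -(ler_pXn2r (n := 2))// ?nnegrE ?l2norm_ge0// sqr_l2norm.
rewrite real_normK ?num_real// (bigD1 i)//= lerDl.
by rewrite sumr_ge0// => j _; exact: sqr_ge0.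
Qed.

Lemma l2normZ c x : l2norm (c *: x) = `|c| * l2norm x.
Proof.
rewrite /l2norm -sqrtr_sqr -sqrtrM ?sqr_ge0// mulr_sumr.
by congr Num.sqrt; apply: eq_bigr => i _; rewrite mxE exprMn.
Qed.

Lemma simplex_le1 x i : simplex x -> x i 0 <= 1.
Proof.
by move=> [x0 <-]; rewrite (bigD1 i)//= lerDl sumr_ge0.
Qed.

Lemma simplex_l1_le2 x y : simplex x -> simplex y ->
  \sum_i `|x i 0 - y i 0| <= 2.
Proof.
move=> [x0 x1] [y0 y1].
have -> : 2 = \sum_i (x i 0 + y i 0) by rewrite big_split/= x1 y1.
apply: ler_sum => i _.
by rewrite (le_trans (ler_normB _ _))// !ger0_norm.
Qed.

Lemma simplex_entryB_le1 x y i : simplex x -> simplex y ->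
  `|x i 0 - y i 0| <= 1.
Proof.
move=> sx sy; have := simplex_le1 i sx; have := simplex_le1 i sy.
by have := sx.1 i; have := sy.1 i; rewrite ler_norml; lra.
Qed.

Lemma simplex_l2B_le2 x y : simplex x -> simplex y -> l2norm (x - y) <= 2.
Proof.
move=> sx sy.
rewrite -(ler_pXn2r (n := 2))// ?nnegrE ?l2norm_ge0// sqr_l2norm.
apply: (@le_trans _ _ (\sum_i `|x i 0 - y i 0|)); last first.
  by apply: (le_trans (simplex_l1_le2 sx sy)); rewrite expr2; lra.
apply: ler_sum => i _; rewrite !mxE -real_normK ?num_real// expr2.
by rewrite ler_piMl// simplex_entryB_le1.
Qed.

(* The coordinates of the projection of v are the max(v_i - r, 0). *)
Lemma simplex_threshold v : (0 < m)%N ->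
  exists r, \sum_i Num.max (v i 0 - r) 0 = 1.
Proof.
move=> m0; pose i0 := Ordinal m0.
pose f r := \sum_i Num.max (v i 0 - r) 0.
pose B := \sum_i `|v i 0|.
have vB i : `|v i 0| <= B.
  by rewrite /B (bigD1 i)//= lerDl sumr_ge0.
have B0 : 0 <= B by apply: sumr_ge0.
have fB : f B = 0.
  apply: big1 => i _; apply/max_idPr.
  by rewrite subr_le0 (le_trans (ler_norm _)).
have fB1 : 1 <= f (- B - 1).
  rewrite /f (bigD1 i0)//= -[leLHS]addr0 lerD//; last first.
    by apply: sumr_ge0 => i _; rewrite le_max lexx orbT.
  rewrite le_max; apply/orP; left.
  have := vB i0; rewrite ler_norml => /andP[]; lra.
have cf : continuous f.
  apply: continuous_big => [|i _].
    exact: add_continuous.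
  move=> x; apply: (continuous_max (f := fun r : R => v i 0 - r) (g := fun=> 0));
    last exact: cvg_cst.
  by apply: cvgB; [exact: cvg_cst|exact: cvg_id].
have BB : - B - 1 <= B by lra.
have [|r _ fr] := IVT (v := 1) BB (continuous_subspaceT cf).
  by rewrite fB ge_min le_max ler01 orbT fB1.
by exists r.
Qed.

(** The thresholded vector of [simplex_threshold] satisfies the variational inequality, and this
    inequality makes it the unique nearest point, hence the value picked by [xget]. *)
Lemma proj_simplexP v : (0 < m)%N ->
  simplex (proj_simplex v) /\
  forall z, simplex z ->
    \sum_i (v i 0 - proj_simplex v i 0) * (z i 0 - proj_simplex v i 0) <= 0.
Proof.
move=> m0; have [r r1] := simplex_threshold v m0.
pose x : 'cV[R]_m := \col_i Num.max (v i 0 - r) 0.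
have sx : simplex x.
  split=> [i|]; first by rewrite mxE le_max lexx orbT.
  by rewrite -r1; apply: eq_bigr => i _; rewrite mxE.
have VIx z : simplex z -> \sum_i (v i 0 - x i 0) * (z i 0 - x i 0) <= 0.
  move=> sz.
  (* Shifting v by the constant r changes nothing, as z - x sums to 0. After the shift each term is
     nonpositive, because x_i is v_i - r, or else 0 >= v_i - r. *)
  have r0 : \sum_i r * (z i 0 - x i 0) = 0.
    by rewrite -mulr_sumr sumrB sz.2 sx.2 subrr mulr0.
  rewrite -[leRHS]r0; apply: ler_sum => i _; rewrite mxE.
  have := sz.1 i; set zi := z i 0; set vi := v i 0 => zi0.
  by case: (leP (vi - r) 0) => ?; nra.
(* The surplus |z - x|^2 kept here yields uniqueness as well as minimality. *)
have gap z : simplex z -> \sum_i (v - x) i 0 ^+ 2 + \sum_i (z - x) i 0 ^+ 2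
    <= \sum_i (v - z) i 0 ^+ 2.
  move=> /VIx H.
  have -> : \sum_i (v - z) i 0 ^+ 2 = \sum_i (v - x) i 0 ^+ 2
    + \sum_i (z - x) i 0 ^+ 2 - 2 * \sum_i (v i 0 - x i 0) * (z i 0 - x i 0).
    rewrite -big_split mulr_sumr -sumrB; apply: eq_bigr => i _ /=.
    by rewrite !mxE; ring.
  lra.
suff -> : proj_simplex v = x by [].
rewrite /proj_simplex; apply: xget_unique => /=.
  split=> // z /gap H; rewrite ler_l2norm.
  by apply: le_trans H; rewrite lerDl sumr_ge0// => i _; exact: sqr_ge0.
move=> p [sp pmin]; have := pmin x sx; rewrite ler_l2norm => H.
have := le_trans (gap p sp) H; rewrite gerDl => H0.
have {}H0 : \sum_i (p - x) i 0 ^+ 2 = 0.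
  by apply/eqP; rewrite eq_le H0 sumr_ge0// => i _; exact: sqr_ge0.
apply/matrixP => i j; rewrite [j]ord1.
have /psumr_eq0P := H0 => /(_ (fun i _ => sqr_ge0 _) i isT) /eqP.
by rewrite sqrf_eq0 !mxE subr_eq0 => /eqP.
Qed.

(** Expand |v - z|^2 around the projection p: the cross term has the right sign by [proj_simplexP],
    and |v - p|^2 is dropped. *)
Lemma proj_simplex_l2_le v z : (0 < m)%N -> simplex z ->
  l2norm (proj_simplex v - z) <= l2norm (v - z).
Proof.
move=> m0 sz; have [_ /(_ _ sz)] := proj_simplexP v m0.
rewrite ler_l2norm; set p := proj_simplex v => H.
have -> : \sum_i (v - z) i 0 ^+ 2 = \sum_i (v - p) i 0 ^+ 2
    + \sum_i (p - z) i 0 ^+ 2 - 2 * \sum_i (v i 0 - p i 0) * (z i 0 - p i 0).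
  rewrite -big_split mulr_sumr -sumrB; apply: eq_bigr => i _ /=.
  by rewrite !mxE; ring.
have : 0 <= \sum_i (v - p) i 0 ^+ 2.
  by rewrite sumr_ge0// => i _; exact: sqr_ge0.
lra.
Qed.

End Projection.

(** * Marginals and costs as sums over cells *)

Section Marginals.
Context {R : realType} {n N : nat}.
Implicit Types (P : 'I_N -> 'M[R]_n).

(** Triples (k, i, j) form one finite index type, so that the softmax results apply to the whole
    family of plans at once. *)
Lemma sum_triple (F : 'I_N -> 'I_n -> 'I_n -> R) :
  \sum_k \sum_i \sum_j F k i j
    = \sum_(u : 'I_N * 'I_n * 'I_n) F u.1.1 u.1.2 u.2.
Proof.
rewrite (pair_bigA _ (fun k i => \sum_j F k i j)) /=.
by rewrite (pair_bigA _ (fun p j => F p.1 p.2 j)).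
Qed.

Lemma rsumE (m p : nat) (P : 'M[R]_(m, p)) i : rsum P i 0 = \sum_j P i j.
Proof. by rewrite mxE; apply: eq_bigr => j _; rewrite mxE mulr1. Qed.

Lemma csumE (m p : nat) (P : 'M[R]_(m, p)) j : csum P j 0 = \sum_i P i j.
Proof. by rewrite mxE; apply: eq_bigr => i _; rewrite !mxE mulr1. Qed.

Lemma inner_cV (m : nat) (x y : 'cV[R]_m) : inner x y = \sum_i x i 0 * y i 0.
Proof. by apply: eq_bigr => i _; rewrite big_ord1. Qed.

Lemma l1norm_cV (m : nat) (x : 'cV[R]_m) : l1norm x = \sum_i `|x i 0|.
Proof. by apply: eq_bigr => i _; rewrite big_ord1. Qed.

Lemma sum_rsum P (f : 'I_n -> R) :
  \sum_i f i * rsum (\sum_k P k) i 0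
    = \sum_(u : 'I_N * 'I_n * 'I_n) f u.1.2 * P u.1.1 u.1.2 u.2.
Proof.
rewrite -(sum_triple (fun k i j => f i * P k i j)) exchange_big /=.
apply: eq_bigr => i _; rewrite rsumE mulr_sumr exchange_big /=.
by apply: eq_bigr => j _; rewrite summxE mulr_sumr.
Qed.

Lemma sum_csum P (g : 'I_n -> R) :
  \sum_j g j * csum (\sum_k P k) j 0
    = \sum_(u : 'I_N * 'I_n * 'I_n) g u.2 * P u.1.1 u.1.2 u.2.
Proof.
rewrite -(sum_triple (fun k i j => g j * P k i j)).
rewrite pair_bigA exchange_big /=; apply: eq_bigr => j _.
rewrite -(pair_bigA _ (fun k i => g j * P k i j)) exchange_big /= csumE mulr_sumr.
by apply: eq_bigr => i _; rewrite summxE mulr_sumr.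
Qed.

Lemma sum_inner P (C : 'I_N -> 'M[R]_n) (d : 'I_N -> R) :
  \sum_k d k * inner (P k) (C k)
    = \sum_(u : 'I_N * 'I_n * 'I_n)
        d u.1.1 * (P u.1.1 u.1.2 u.2 * C u.1.1 u.1.2 u.2).
Proof.
rewrite -(sum_triple (fun k i j => d k * (P k i j * C k i j))).
apply: eq_bigr => k _; rewrite mulr_sumr; apply: eq_bigr => i _.
by rewrite mulr_sumr.
Qed.

Lemma cinf_ge (C : 'I_N -> 'M[R]_n) k i j : `|C k i j| <= cinf C.
Proof.
rewrite /cinf; apply: (bigmax_sup k) => //; apply: (bigmax_sup i) => //.
exact: (bigmax_sup j).
Qed.

End Marginals.

(** * Concavity, smoothness and gradient of the dual objective *)

Section Dual.
Context {R : realType} {n N : nat}.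
Variables (eps : R) (a b : 'cV[R]_n) (C : 'I_N -> 'M[R]_n).
Hypotheses (n0 : (0 < n)%N) (N0 : (0 < N)%N) (eta0 : 0 < eta eps C).
Implicit Types (f g : 'cV[R]_n) (l y : 'cV[R]_N).
Local Notation eta := (eta eps C).
Local Notation cinf := (cinf C).
Local Notation gibbs := (gibbs eps C).
Local Notation zeta := (zeta eps C).
Local Notation dualF := (dualF eps a b C).
Local Notation cell := ('I_N * 'I_n * 'I_n)%type.

(** The exponents of [zeta], indexed by cells: [gibbs] becomes their softmax, and [dualF] a linear
    function minus eta times their [lse], up to a constant. *)
Definition logit f g l (u : cell) : R :=
  (f u.1.2 0 + g u.2 0 - l u.1.1 0 * C u.1.1 u.1.2 u.2) / eta.

Let u0 : cell := (Ordinal N0, Ordinal n0, Ordinal n0).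

Lemma mass_zeta f g l :
  \sum_k l1norm (zeta f g l k) = \sum_u expR (logit f g l u).
Proof.
rewrite -(sum_triple (fun k i j => expR (logit f g l (k, i, j)))).
apply: eq_bigr => k _; apply: eq_bigr => i _; apply: eq_bigr => j _.
by rewrite !mxE ger0_norm// expR_ge0.
Qed.

Lemma gibbsE f g l k i j : gibbs f g l k i j = softmax (logit f g l) (k, i, j).
Proof. by rewrite !mxE mass_zeta mulrC. Qed.

Lemma dualFE f g l :
  dualF f g l = inner f a + inner g b - eta * lse (logit f g l) - eta.
Proof. by rewrite /dualF mass_zeta. Qed.

(** This is the first-order term of the Bregman divergence of [lse]: the factor eta clears the
    denominator of [logit], and the three parts of the exponent pair with row sums, column sums and
    costs. *)
Lemma sum_logitB f g l f' g' l' :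
  eta * (\sum_u softmax (logit f g l) u * (logit f' g' l' u - logit f g l u))
  = \sum_i (f' i 0 - f i 0) * rsum (\sum_k gibbs f g l k) i 0
  + \sum_j (g' j 0 - g j 0) * csum (\sum_k gibbs f g l k) j 0
  - \sum_k (l' k 0 - l k 0) * inner (gibbs f g l k) (C k).
Proof.
rewrite (sum_rsum _ (fun i => f' i 0 - f i 0)).
rewrite (sum_csum _ (fun j => g' j 0 - g j 0)).
rewrite (sum_inner _ _ (fun k => l' k 0 - l k 0)).
rewrite -big_split -sumrB mulr_sumr; apply: eq_bigr => -[[k i] j] _ /=.
rewrite gibbsE /logit /=; field.
by rewrite gt_eqF.
Qed.

(** Concavity with a quadratic remainder: [lse_bregman_ge] times eta, with the first-order term read
    off from [sum_logitB]. *)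
Lemma dualF_le f g l f' g' l' :
  dualF f' g' l' <= dualF f g l
    + \sum_i (f' i 0 - f i 0) * (a i 0 - rsum (\sum_k gibbs f g l k) i 0)
    + \sum_j (g' j 0 - g j 0) * (b j 0 - csum (\sum_k gibbs f g l k) j 0)
    + \sum_k (l' k 0 - l k 0) * inner (gibbs f g l k) (C k)
    - eta / 2 * (\sum_u `|softmax (logit f' g' l') u
                          - softmax (logit f g l) u|) ^+ 2.
Proof.
have := lse_bregman_ge u0 (logit f g l) (logit f' g' l').
rewrite -(ler_pM2l eta0) mulrBr sum_logitB !dualFE !inner_cV.
under [X in _ -> _ <= _ + X + _ + _ - _]eq_bigr do rewrite mulrBr mulrBl.
under [X in _ -> _ <= _ + X + _ - _]eq_bigr do rewrite mulrBr mulrBl.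
rewrite !sumrB.
set t := \sum_u _; lra.
Qed.

Lemma logit_lambdaB f g l y D u : (forall k, `|l k 0 - y k 0| <= D) ->
  `|logit f g l u - logit f g y u| <= cinf / eta * D.
Proof.
move=> lyD.
have -> : logit f g l u - logit f g y u
    = - ((l u.1.1 0 - y u.1.1 0) * C u.1.1 u.1.2 u.2 / eta).
  by rewrite /logit; ring.
rewrite normrN !normrM [X in _ * _ * X]ger0_norm ?invr_ge0 ?(ltW eta0)//.
rewrite [leRHS]mulrAC ler_pM2r ?invr_gt0// mulrC.
by rewrite ler_pM// cinf_ge.
Qed.

Lemma softmax_lambda_l1 f g l y D : (forall k, `|l k 0 - y k 0| <= D) ->
  \sum_u `|softmax (logit f g l) u - softmax (logit f g y) u|
    <= cinf / eta * D.
Proof.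
by move=> lyD; apply: (softmax_lipschitz u0) => u; exact: logit_lambdaB.
Qed.

(** A change of lambda by at most D in each entry moves every logit by at most cinf / eta * D, and
    [lse_smooth] then gives the smoothness constant cinf^2 / eta. *)
Lemma dualF_lambda_ge f g l y D : (forall k, `|l k 0 - y k 0| <= D) ->
  dualF f g y + \sum_k (l k 0 - y k 0) * inner (gibbs f g y k) (C k)
    - cinf ^+ 2 / eta / 2 * D ^+ 2 <= dualF f g l.
Proof.
move=> lyD.
have := lse_smooth u0 (fun u => logit_lambdaB f g u lyD).
rewrite -(ler_pM2l eta0) mulrBr sum_logitB !dualFE.
rewrite [X in _ - (X + _ - _)]big1 => [|i _]; last by rewrite subrr mul0r.
rewrite [X in _ - (_ + X - _)]big1 => [|i _]; last by rewrite subrr mul0r.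
have -> : eta * ((cinf / eta * D) ^+ 2 / 2) = cinf ^+ 2 / eta / 2 * D ^+ 2.
  by field; rewrite gt_eqF.
lra.
Qed.

(** Concavity bounds the increment in direction k from above by h G, and smoothness bounds it from
    below by h G - L h^2, so the difference quotient is within L |h| of G. *)
Lemma gradient_dualF f g y k :
  gradient (dualF f g) y k 0 = inner (gibbs f g y k) (C k).
Proof.
rewrite mxE /derive; set G := inner _ _; set v := delta_mx k 0.
pose L := cinf ^+ 2 / eta / 2.
have dG (h : R) :
  \sum_m ((h *: v + y) m 0 - y m 0) * inner (gibbs f g y m) (C m) = h * G.
  rewrite (bigD1 k)//= big1 ?addr0 => [|m mk]; rewrite !mxE.
    by rewrite eqxx mulr1 addrK.
  by rewrite (negbTE mk) andFb mulr0 add0r subrr mul0r.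
have bnd (h : R) : h != 0 ->
    `|h^-1 *: ((dualF f g \o shift y) (h *: v) - dualF f g y) - G| <= L * `|h|.
  move=> h0 /=.
  have hD m : `|(h *: v + y) m 0 - y m 0| <= `|h|.
    rewrite !mxE andbT addrK normrM.
    by case: (m == k); rewrite ?normr1 ?mulr1// normr0 mulr0.
  have := dualF_lambda_ge f g hD; have := dualF_le f g y f g (h *: v + y).
  rewrite dG -/L real_normK ?num_real//.
  rewrite [X in _ + X + _ + _ - _]big1 => [|i _]; last by rewrite subrr mul0r.
  rewrite [X in _ + _ + X + _ - _]big1 => [|i _]; last by rewrite subrr mul0r.
  rewrite !addr0 => up lo.
  have -> : L * `|h| = L * h ^+ 2 * `|h^-1|.
    rewrite normfV -[h ^+ 2]real_normK ?num_real// expr2; field.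
    by rewrite normr_eq0.
  have -> : h^-1 *: (dualF f g (h *: v + y) - dualF f g y) - G
     = (dualF f g (h *: v + y) - dualF f g y - h * G) * h^-1.
    by rewrite /GRing.scale /=; field.
  rewrite normrM ler_wpM2r// ler_norml.
  set t := \sum_u _ in up.
  have ? : 0 <= eta / 2 * t ^+ 2 by rewrite mulr_ge0 ?sqr_ge0// divr_ge0 ?(ltW eta0).
  have : 0 <= L * h ^+ 2.
    rewrite mulr_ge0 ?sqr_ge0// /L !divr_ge0 ?sqr_ge0 ?(ltW eta0)//.
  lra.
apply/cvg_lim => //; apply/cvgrPdist_le => e e0.
have L0 : 0 <= L by rewrite /L !divr_ge0 ?sqr_ge0 ?(ltW eta0).
near=> h.
rewrite distrC (le_trans (bnd h _))//.
  near: h; exact: nbhs_dnbhs_neq.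
(* [L] is only known to be nonnegative here; [L + 1] can be divided by. *)
rewrite (@le_trans _ _ ((L + 1) * `|h|))// ?ler_wpM2r// ?lerDl//.
rewrite mulrC -ler_pdivlMr ?ltr_wpDl//.
near: h.
apply: dnbhs0_le.
by rewrite divr_gt0// ltr_wpDl.
Unshelve. all: by end_near. Qed.

End Dual.

(** * Row and column updates, and oscillation of the column potential *)

Section Sinkhorn.
Context {R : realType} {n N : nat}.
Variables (eps : R) (a b : 'cV[R]_n) (C : 'I_N -> 'M[R]_n).
Hypotheses (n0 : (0 < n)%N) (N0 : (0 < N)%N) (eta0 : 0 < eta eps C).
Hypotheses (sa : simplex a) (sb : simplex b).
Hypotheses (a0 : forall i, 0 < a i 0) (b0 : forall j, 0 < b j 0).
Implicit Types (f g : 'cV[R]_n) (l y : 'cV[R]_N).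
Local Notation eta := (eta eps C).
Local Notation cinf := (cinf C).
Local Notation gibbs := (gibbs eps C).
Local Notation zeta := (zeta eps C).
Local Notation dualF := (dualF eps a b C).
Local Notation logit := (logit eps C).
Local Notation cell := ('I_N * 'I_n * 'I_n)%type.

(** The two Sinkhorn updates are stated apart from [pame_step] so that [col_update] can also be
    applied to a dual maximizer. *)
Definition row_update f g l : 'cV[R]_n :=
  \col_i (f i 0 + eta * ln (a i 0 / rsum (\sum_k zeta f g l k) i 0)).

Definition col_update f g l : 'cV[R]_n :=
  \col_j (g j 0 + eta * ln (b j 0 / csum (\sum_k zeta f g l k) j 0)).

Lemma zetaE f g l k i j : zeta f g l k i j = expR (logit f g l (k, i, j)).
Proof. by rewrite mxE. Qed.

Lemma rsum_zeta f g l i :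
  rsum (\sum_k zeta f g l k) i 0
    = \sum_(p : 'I_N * 'I_n) expR (logit f g l (p.1, i, p.2)).
Proof.
rewrite rsumE -(pair_bigA _ (fun k j => expR (logit f g l (k, i, j)))).
rewrite exchange_big; apply: eq_bigr => j _ /=.
by rewrite summxE; apply: eq_bigr => k _; rewrite zetaE.
Qed.

Lemma csum_zeta f g l j :
  csum (\sum_k zeta f g l k) j 0
    = \sum_(p : 'I_N * 'I_n) expR (logit f g l (p.1, p.2, j)).
Proof.
rewrite csumE -(pair_bigA _ (fun k i => expR (logit f g l (k, i, j)))).
rewrite exchange_big; apply: eq_bigr => i _ /=.
by rewrite summxE; apply: eq_bigr => k _; rewrite zetaE.
Qed.

Lemma sum_pair_expR_gt0 (s : 'I_N * 'I_n -> R) : 0 < \sum_p expR (s p).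
Proof. by rewrite (sum_expR_gt0 (Ordinal N0, Ordinal n0)). Qed.

Lemma rsum_row_update f g l :
  rsum (\sum_k zeta (row_update f g l) g l k) = a.
Proof.
apply/matrixP => i j; rewrite [j]ord1 rsum_zeta {j}.
have r0 : 0 < rsum (\sum_k zeta f g l k) i 0.
  by rewrite rsum_zeta sum_pair_expR_gt0.
transitivity (\sum_(p : 'I_N * 'I_n) expR (logit f g l (p.1, i, p.2))
   * (a i 0 / rsum (\sum_k zeta f g l k) i 0)).
  apply: eq_bigr => -[k j] _ /=.
  rewrite -[X in _ * X]lnK ?posrE ?divr_gt0// -expRD /logit /= mxE.
  by congr expR; field; rewrite gt_eqF.
by rewrite -mulr_suml -rsum_zeta mulrC divfK// gt_eqF.
Qed.

Lemma col_updateE f g l k i j :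
  expR (logit f (col_update f g l) l (k, i, j))
    = expR (logit f g l (k, i, j))
      * (b j 0 / csum (\sum_k zeta f g l k) j 0).
Proof.
have r0 : 0 < csum (\sum_k zeta f g l k) j 0.
  by rewrite csum_zeta sum_pair_expR_gt0.
rewrite -[X in _ * X]lnK ?posrE ?divr_gt0// -expRD /logit /= mxE.
by congr expR; field; rewrite gt_eqF.
Qed.

Lemma csum_col_update f g l :
  csum (\sum_k zeta f (col_update f g l) l k) = b.
Proof.
apply/matrixP => j i; rewrite [i]ord1 csum_zeta {i}.
transitivity (\sum_(p : 'I_N * 'I_n) expR (logit f g l (p.1, p.2, j))
   * (b j 0 / csum (\sum_k zeta f g l k) j 0)).
  by apply: eq_bigr => -[k i] _ /=; rewrite col_updateE.
rewrite -mulr_suml -csum_zeta mulrC divfK// gt_eqF//.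
by rewrite csum_zeta sum_pair_expR_gt0.
Qed.

Lemma mass_rsum f g l : rsum (\sum_k zeta f g l k) = a ->
  \sum_u expR (logit f g l u) = 1.
Proof.
move=> ra; rewrite -sa.2 -ra.
have := sum_rsum (zeta f g l) (fun=> 1).
under eq_bigr do rewrite mul1r.
move=> ->; apply: eq_bigr => -[[k i] j] _ /=.
by rewrite mul1r zetaE.
Qed.

Lemma mass_csum f g l : csum (\sum_k zeta f g l k) = b ->
  \sum_u expR (logit f g l u) = 1.
Proof.
move=> cb; rewrite -sb.2 -cb.
have := sum_csum (zeta f g l) (fun=> 1).
under eq_bigr do rewrite mul1r.
move=> ->; apply: eq_bigr => -[[k i] j] _ /=.
by rewrite mul1r zetaE.
Qed.

Lemma gibbs_zeta f g l : \sum_u expR (logit f g l u) = 1 ->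
  gibbs f g l = zeta f g l.
Proof.
by move=> m1; apply/funext => k; rewrite /gibbs mass_zeta m1 invr1 scale1r.
Qed.

Lemma softmax_mass1 f g l u : \sum_u expR (logit f g l u) = 1 ->
  softmax (logit f g l) u = expR (logit f g l u).
Proof. by rewrite /softmax => ->; rewrite divr1. Qed.

(** The update multiplies column j of the plan by b_j / c_j, and both plans have mass 1, so column j
    contributes |b_j / c_j - 1| c_j = |b_j - c_j|. *)
Lemma col_update_l1 f g l : \sum_u expR (logit f g l u) = 1 ->
  \sum_u `|softmax (logit f (col_update f g l) l) u - softmax (logit f g l) u|
    = l1norm (csum (\sum_k gibbs f g l k) - b).
Proof.
move=> m1; have m1' := mass_csum (csum_col_update f g l).
rewrite l1norm_cV gibbs_zeta//.
rewrite (eq_bigr (fun u : cell => `|b u.2 0 / csum (\sum_k zeta f g l k) u.2 0 - 1|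
    * zeta f g l u.1.1 u.1.2 u.2)).
  rewrite -(sum_csum (zeta f g l)
    (fun j => `|b j 0 / csum (\sum_k zeta f g l k) j 0 - 1|)).
  apply: eq_bigr => j _.
  have c0 : 0 < csum (\sum_k zeta f g l k) j 0.
    by rewrite csum_zeta sum_pair_expR_gt0.
  rewrite -[X in _ * X]gtr0_norm// -normrM mulrBl divfK ?gt_eqF// mul1r.
  by rewrite distrC !mxE.
move=> [[k i] j] _ /=; rewrite !softmax_mass1// col_updateE zetaE.
rewrite -[X in _ = _ * X]gtr0_norm ?expR_gt0// -normrM.
by congr `| _ |; ring.
Qed.

(** [dualF_le] is based at the updated point: there the row sums equal a, so the first-order term
    vanishes. *)
Lemma dualF_row_update f g l : dualF f g l <= dualF (row_update f g l) g l.
Proof.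
have ra := rsum_row_update f g l.
have := dualF_le a b n0 N0 eta0 (row_update f g l) g l f g l.
rewrite (gibbs_zeta (mass_rsum ra)) ra.
rewrite [X in _ + X + _ + _ - _]big1 => [|i _]; last by rewrite subrr mulr0.
rewrite [X in _ + _ + X + _ - _]big1 => [|i _]; last by rewrite subrr mul0r.
rewrite [X in _ + _ + _ + X - _]big1 => [|i _]; last by rewrite subrr mul0r.
rewrite !addr0 => /le_trans; apply; rewrite gerBl.
by rewrite mulr_ge0 ?sqr_ge0// divr_ge0 ?ltW.
Qed.

(** As for the rows, but the quadratic remainder is kept: it is the gain of the column step. *)
Lemma dualF_col_update f g l :
  dualF f g l <= dualF f (col_update f g l) l
    - eta / 2 * (\sum_u `|softmax (logit f (col_update f g l) l) u
                          - softmax (logit f g l) u|) ^+ 2.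
Proof.
have cb := csum_col_update f g l.
have := dualF_le a b n0 N0 eta0 f (col_update f g l) l f g l.
rewrite (gibbs_zeta (mass_csum cb)) cb.
rewrite [X in _ + X + _ + _ - _]big1 => [|i _]; last by rewrite subrr mul0r.
rewrite [X in _ + _ + X + _ - _]big1 => [|i _]; last by rewrite subrr mulr0.
rewrite [X in _ + _ + _ + X - _]big1 => [|i _]; last by rewrite subrr mul0r.
by under eq_bigr do rewrite distrC; rewrite !addr0.
Qed.

Lemma iota_b_le j : iota_b b <= ln (b j 0).
Proof. exact: bigmin_le. Qed.

Lemma iota_b_le0 : iota_b b <= 0.
Proof. exact: bigmin_le_id. Qed.

(** Entries of column j are at least expR ((g_j - g_j' - 2 cinf) / eta) times those of column j'.
    Hence b_j' times this factor is at most b_j <= 1, while b_j' is at least expR iota. *)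
Lemma col_potential_osc f g l j j' :
  csum (\sum_k zeta f g l k) = b -> simplex l ->
  g j 0 - g j' 0 <= 2 * cinf - eta * iota_b b.
Proof.
move=> cb sl.
have bE i : b i 0 = \sum_(p : 'I_N * 'I_n) expR (logit f g l (p.1, p.2, i)).
  by rewrite -csum_zeta cb.
have : b j' 0 * expR ((g j 0 - g j' 0 - 2 * cinf) / eta) <= b j 0.
  rewrite !bE mulr_suml; apply: ler_sum => -[k i] _ /=.
  rewrite -expRD ler_expR /logit /= -mulrDl ler_pM2r ?invr_gt0//.
  have lC m : `|l k 0 * C k i m| <= cinf.
    rewrite normrM -[cinf]mul1r ler_pM ?cinf_ge//.
    by rewrite ger0_norm ?simplex_le1//; exact: sl.1.
  have := lC j; have := lC j'; rewrite !ler_norml; lra.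
have bj1 : b j 0 <= 1 := simplex_le1 j sb.
have bj'E : expR (iota_b b) <= b j' 0.
  by rewrite -[leRHS]lnK ?posrE// ler_expR iota_b_le.
move=> H; have : expR (iota_b b) * expR ((g j 0 - g j' 0 - 2 * cinf) / eta) <= 1.
  by apply: le_trans bj1; apply: le_trans H; rewrite ler_wpM2r ?expR_ge0.
rewrite -expRD -expR0 ler_expR -lerBrDl sub0r ler_pdivrMr//.
lra.
Qed.

(** As d sums to 0, g may be shifted by its midrange, after which its absolute value is at most K /
    2. *)
Lemma sum_osc_le (d g : 'I_n -> R) (K : R) :
  \sum_j d j = 0 -> (forall j j', g j - g j' <= K) ->
  \sum_j d j * g j <= K / 2 * \sum_j `|d j|.
Proof.
move=> d0 gK.
pose i0 := Ordinal n0.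
have [jM _ gM] : exists2 j, true & forall i, g i <= g j.
  by case: (@arg_maxP _ _ _ i0 predT g isT) => j _ H; exists j => // i; exact: H.
have [jm _ gm] : exists2 j, true & forall i, g j <= g i.
  by case: (@arg_minP _ _ _ i0 predT g isT) => j _ H; exists j => // i; exact: H.
pose m := (g jM + g jm) / 2.
have -> : \sum_j d j * g j = \sum_j d j * (g j - m).
  by under [RHS]eq_bigr do rewrite mulrBr; rewrite sumrB -mulr_suml d0 mul0r subr0.
rewrite mulr_sumr; apply: ler_sum => j _.
rewrite mulrC (le_trans (ler_norm _))// normrM ler_wpM2r// /m ler_norml.
have := gK jM jm; have := gM j; have := gm j; lra.
Qed.

End Sinkhorn.

(** * The margin procedure: invariants and termination *)

Section Margins.
Context {R : realType} {n N : nat}.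
Variables (P : 'I_N -> 'M[R]_n) (b : 'cV[R]_n).
Hypothesis P0 : forall k i j, 0 < P k i j.
Hypothesis b0 : forall j, 0 < b j 0.
Hypothesis N0 : (0 < N)%N.
Hypothesis mass : \sum_j csum (\sum_k P k) j 0 = \sum_j b j 0.
Implicit Types B : 'I_N -> 'cV[R]_n.
Local Notation c k j := (csum (P k) j 0).
Local Notation ctot j := (csum (\sum_k P k) j 0).

Let c0 k j : 0 <= c k j.
Proof. by rewrite csumE sumr_ge0// => i _; exact/ltW. Qed.

Let ctotE j : ctot j = \sum_k c k j.
Proof.
under [RHS]eq_bigr do rewrite csumE.
by rewrite exchange_big csumE; apply: eq_bigr => i _; rewrite summxE.
Qed.

(** What the loop preserves: the total b, the masses of the plans, and the sign condition in
    explicit form, every deviation in column j having the sign of b_j minus the column sum of the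
    plans. *)
Definition margins_inv B : Prop :=
  [/\ forall j, \sum_k B k j 0 = b j 0,
      forall k, \sum_j B k j 0 = \sum_j c k j,
      forall j k, ctot j <= b j 0 -> c k j <= B k j 0
    & forall j k, b j 0 <= ctot j -> B k j 0 <= c k j].

Lemma margins_init_inv : margins_inv (margins_init P b).
Proof.
have NV0 : 0 <= N%:R^-1 :> R by rewrite invr_ge0.
have E k j : margins_init P b k j 0 = c k j + N%:R^-1 * (b j 0 - ctot j).
  rewrite /margins_init; move: (csum (P k)) (csum (\sum_l P l)) => X Y.
  by rewrite !mxE.
split=> [j|k|j k|j k].
- under eq_bigr do rewrite E.
  rewrite big_split/= -ctotE sumr_const card_ord -mulrnAl -[N%:R^-1 *+ N]mulr_natr.
  by rewrite mulVf ?mul1r ?subrKC// pnatr_eq0 -lt0n.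
- under eq_bigr do rewrite E.
  by rewrite big_split/= -mulr_sumr sumrB mass subrr mulr0 addr0.
- by rewrite E lerDl => ?; rewrite mulr_ge0// subr_ge0.
- by rewrite E gerDl => ?; rewrite mulr_ge0_le0// subr_le0.
Qed.

Definition transfer B (k k' : 'I_N) (j j' : 'I_n) (vt : R) : 'I_N -> 'cV[R]_n :=
  fun l => B l
    + (vt * (l == k)%:R) *: (delta_mx j 0 - delta_mx j' 0)
    + (vt * (l == k')%:R) *: (delta_mx j' 0 - delta_mx j 0).

Lemma transferE B k k' j j' vt l m :
  transfer B k k' j j' vt l m 0
    = B l m 0 + vt * ((l == k)%:R - (l == k')%:R) * ((m == j)%:R - (m == j')%:R).
Proof. by rewrite !mxE !eqxx !andbT; ring. Qed.

Definition transfer_amount B (k k' : 'I_N) (j j' : 'I_n) : R :=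
  Num.min `|B k j 0| (Num.min `|B k' j 0| `|B k j' 0 - c k j'|).

Section Step.
Variables (B : 'I_N -> 'cV[R]_n) (k k' : 'I_N) (j j' : 'I_n).
Hypothesis Binv : margins_inv B.
Hypotheses (Bkj : B k j 0 < 0) (Bkj' : c k j' < B k j' 0) (Bk'j : 0 < B k' j 0).
Let vt := transfer_amount B k k' j j'.
Let B' := transfer B k k' j j' vt.

Lemma transfer_amount_bounds :
  [/\ 0 < vt, vt <= - B k j 0, vt <= B k' j 0 & vt <= B k j' 0 - c k j'].
Proof.
have -> : vt = Num.min (- B k j 0) (Num.min (B k' j 0) (B k j' 0 - c k j')).
  by rewrite /vt /transfer_amount ltr0_norm// !gtr0_norm// subr_gt0.
split; last 3 first.
- by rewrite ge_min lexx.
- by rewrite !ge_min lexx orbT.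
- by rewrite !ge_min lexx !orbT.
by rewrite !lt_min oppr_gt0 Bkj Bk'j subr_gt0.
Qed.

Lemma transfer_amount_case :
  [\/ vt = - B k j 0, vt = B k' j 0 | vt = B k j' 0 - c k j'].
Proof.
have -> : vt = Num.min (- B k j 0) (Num.min (B k' j 0) (B k j' 0 - c k j')).
  by rewrite /vt /transfer_amount ltr0_norm// !gtr0_norm// subr_gt0.
case: (leP (- B k j 0) _) => _; first by constructor 1.
by case: leP => _; [constructor 2|constructor 3].
Qed.

Lemma transfer_neq : k != k' /\ j != j'.
Proof.
split; apply/eqP => E.
  by move: Bk'j; rewrite -E ltNge (ltW Bkj).
by have := le_lt_trans (c0 k j') Bkj'; rewrite -E ltNge (ltW Bkj).
Qed.

Lemma transfer_kj : B' k j 0 = B k j 0 + vt.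
Proof.
have [kk jj] := transfer_neq.
by rewrite transferE !eqxx (negbTE kk) (negbTE jj) !subr0 !mulr1.
Qed.

Lemma transfer_k'j : B' k' j 0 = B k' j 0 - vt.
Proof.
have [kk jj] := transfer_neq.
by rewrite transferE !eqxx (eq_sym k') (negbTE kk) (negbTE jj) subr0 sub0r mulr1 mulrN1.
Qed.

Lemma transfer_kj' : B' k j' 0 = B k j' 0 - vt.
Proof.
have [kk jj] := transfer_neq.
by rewrite transferE !eqxx (eq_sym j') (negbTE jj) (negbTE kk) subr0 sub0r mulr1 mulrN1.
Qed.

Lemma transfer_k'j' : B' k' j' 0 = B k' j' 0 + vt.
Proof.
have [kk jj] := transfer_neq.
rewrite transferE !eqxx (eq_sym k') (eq_sym j') (negbTE jj) (negbTE kk) !sub0r.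
by rewrite !mulrN1 opprK.
Qed.

Lemma transfer_other l m :
  ~~ ((l == k) || (l == k')) || ~~ ((m == j) || (m == j')) ->
  B' l m 0 = B l m 0.
Proof.
rewrite transferE !negb_or => /orP[|] /andP[/negbTE-> /negbTE->].
  by rewrite subrr mulr0 mul0r addr0.
by rewrite subrr mulr0 addr0.
Qed.

(** A pass touches four distinct entries, so an entrywise property is checked on these four and on
    the old margins. *)
Lemma transfer_ind (Q : 'I_N -> 'I_n -> R -> Prop) :
  Q k j (B k j 0 + vt) -> Q k' j (B k' j 0 - vt) ->
  Q k j' (B k j' 0 - vt) -> Q k' j' (B k' j' 0 + vt) ->
  (forall l m, Q l m (B l m 0)) -> forall l m, Q l m (B' l m 0).
Proof.
move=> q1 q2 q3 q4 q5 l m.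
have [->|lk] := eqVneq l k.
  have [->|mj] := eqVneq m j; first by rewrite transfer_kj.
  have [->|mj'] := eqVneq m j'; first by rewrite transfer_kj'.
  by rewrite transfer_other// (negbTE mj) (negbTE mj') orbT.
have [->|lk'] := eqVneq l k'.
  have [->|mj] := eqVneq m j; first by rewrite transfer_k'j.
  have [->|mj'] := eqVneq m j'; first by rewrite transfer_k'j'.
  by rewrite transfer_other// (negbTE mj) (negbTE mj') orbT.
by rewrite transfer_other// (negbTE lk) (negbTE lk').
Qed.

Lemma transfer_inv : margins_inv B'.
Proof.
have [v0 v1 v2 v3] := transfer_amount_bounds.
have [bs cs up lo] := Binv.
have sumd (I : finType) (i i' : I) : \sum_m (((m == i)%:R : R) - (m == i')%:R) = 0.
  have one (i1 : I) : \sum_m ((m == i1)%:R : R) = 1.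
    by rewrite (bigD1 i1)//= eqxx big1 ?addr0// => m /negbTE->.
  by rewrite sumrB !one subrr.
(* A negative entry lies below [c k j], so by the invariant column j is overfull; likewise the
   surplus at j' shows that column j' is underfull. *)
have dj : b j 0 < ctot j.
  by rewrite ltNge; apply/negP => /(up j k)/(le_trans (c0 k j)); rewrite leNgt Bkj.
have dj' : ctot j' < b j' 0.
  by rewrite ltNge; apply/negP => /(lo j' k); rewrite leNgt Bkj'.
split=> [m|l||].
- under eq_bigr do rewrite transferE.
  by rewrite big_split/= -mulr_suml -mulr_sumr sumd mulr0 mul0r addr0.
- under eq_bigr do rewrite transferE.
  by rewrite big_split/= -mulr_sumr sumd mulr0 addr0.
- move=> m l; move: l m.
  apply: (transfer_ind (Q := fun l m t => ctot m <= b m 0 -> c l m <= t))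
    => [|||/(up j' k')|l m]; last exact: up.
  + by rewrite leNgt dj.
  + by rewrite leNgt dj.
  + lra.
  + lra.
- move=> m l; move: l m.
  apply: (transfer_ind (Q := fun l m t => b m 0 <= ctot m -> t <= c l m))
    => [||||l m]; last exact: lo.
  + by move=> _; have := c0 k j; lra.
  + by move/(lo j k'); lra.
  + by rewrite leNgt dj'.
  + by rewrite leNgt dj'.
Qed.

(** The amount is at most B k' j and at most B k j' - c k j' <= B k j', so the two decreased entries
    stay nonnegative. *)
Lemma transfer_neg l m : B' l m 0 < 0 -> B l m 0 < 0.
Proof.
have [v0 v1 v2 v3] := transfer_amount_bounds.
have := c0 k j'; move=> ?.
by move: l m; apply: (transfer_ind (Q := fun l m t => t < 0 -> B l m 0 < 0)) => //; lra.
Qed.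

End Step.

Lemma margins_reach_inv B : margins_reach P b B -> margins_inv B.
Proof.
elim=> [|B1 B2 _ IH [k [k' [j [j' [? ? ? ->]]]]]]; first exact: margins_init_inv.
exact: transfer_inv.
Qed.

Definition negatives B : {set 'I_N * 'I_n} := [set p | B p.1 p.2 0 < 0].

(* With the negative entry (k, j) kept fixed, each pass either repairs it, or
   empties an entry of column j, or exhausts a surplus of row k. *)
Lemma margins_fix_entry B k j : margins_reach P b B -> B k j 0 < 0 ->
  exists2 B', margins_reach P b B' & negatives B' \proper negatives B.
Proof.
pose pos B := [set l | 0 < B l j 0]; pose sur B := [set m | c k m < B k m 0].
have [m] := ubnP (#|pos B| + #|sur B|).
elim: m B => // m IH B; rewrite ltnS => Bm HB Bkj.
have [bs cs _ _] := margins_reach_inv HB.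
(* Row k has the right total and a deficit at j, hence a surplus elsewhere; column j has the
   positive total b_j, hence a positive entry. *)
have [j' Bkj'] : exists j', c k j' < B k j' 0.
  case: (boolP [exists j', c k j' < B k j' 0]) => [/existsP//|/existsPn H].
  have /eqP := cs k; rewrite lt_eqF//.
  rewrite (bigD1 j)//= [ltRHS](bigD1 j)//= ltr_leD ?(lt_le_trans Bkj)//.
  by apply: ler_sum => i _; rewrite leNgt.
have [k' Bk'j] : exists k', 0 < B k' j 0.
  case: (boolP [exists k', 0 < B k' j 0]) => [/existsP//|/existsPn H].
  have := b0 j; rewrite -bs ltNge sumr_le0// => i _; by rewrite leNgt.
have Binv := margins_reach_inv HB.
pose vt := transfer_amount B k k' j j'.
pose B' := transfer B k k' j j' vt.
have HB' : margins_reach P b B'.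
  by apply: margins_next HB _; exists k, k', j, j'; split.
have [v0 v1 v2 v3] := transfer_amount_bounds Bkj Bkj' Bk'j.
have negS : negatives B' \subset negatives B.
  by apply/fintype.subsetP => -[l i]; rewrite !inE /=; exact: transfer_neg.
have B'kj := transfer_kj Bkj Bkj' Bk'j.
have [B'kj0|B'kj0] := ltP (B' k j 0) 0; last first.
  exists B' => //; apply/properP; split=> //.
  by exists (k, j); rewrite !inE //= -leNgt.
have posS : pos B' \subset pos B.
  apply/fintype.subsetP => l; rewrite !inE.
  have [->|lk] := eqVneq l k; first by rewrite ltNge (ltW B'kj0).
  have [->|lk'] := eqVneq l k'; first by [].
  by rewrite transfer_other// (negbTE lk) (negbTE lk').
have surS : sur B' \subset sur B.
  apply/fintype.subsetP => l; rewrite !inE.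
  have [->|lj] := eqVneq l j; first by move=> /lt_trans/(_ B'kj0); rewrite ltNge c0.
  have [->|lj'] := eqVneq l j'; first by [].
  by rewrite transfer_other// (negbTE lj) (negbTE lj') orbT.
suff lt : (#|pos B'| + #|sur B'| < #|pos B| + #|sur B|)%N.
  have [B2 HB2 sB2] := IH B' (leq_trans lt Bm) HB' B'kj0.
  by exists B2 => //; exact: proper_sub_trans sB2 negS.
have [E|E|E] := transfer_amount_case Bkj Bkj' Bk'j.
- by move: B'kj0; rewrite B'kj E subrr ltxx.
- have /proper_card : pos B' \proper pos B.
    apply/properP; split=> //; exists k'; rewrite !inE//.
    by rewrite (transfer_k'j Bkj Bkj' Bk'j) E subrr ltxx.
  by move=> lt; rewrite -addSn leq_add// subset_leq_card.
- have /proper_card : sur B' \proper sur B.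
    apply/properP; split=> //; exists j'; rewrite !inE//.
    by rewrite (transfer_kj' Bkj Bkj' Bk'j) E subKr ltxx.
  by move=> lt; rewrite -addnS leq_add// subset_leq_card.
Qed.

(** Repeated use of [margins_fix_entry] terminates, as the set of negative entries shrinks strictly
    each time. *)
Lemma margins_exists : exists B, margins P b B.
Proof.
suff [B HB Bn] : exists2 B, margins_reach P b B & negatives B = finset.set0.
  exists B; split=> // k j; rewrite leNgt; apply/negP => Bkj.
  have : (k, j) \in negatives B by rewrite inE.
  by rewrite Bn inE.
suff H m B : (#|negatives B| < m)%N -> margins_reach P b B ->
    exists2 B, margins_reach P b B & negatives B = finset.set0.
  exact: (H #|negatives (margins_init P b)|.+1 _ (ltnSn _) (margins_start _ _)).
elim: m B => // m IH B; rewrite ltnS => Bm HB.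
have [E|[[k j]]] := finset.set_0Vmem (negatives B); first by exists B.
rewrite inE /= => /(margins_fix_entry HB)[B' HB' /proper_card lt].
exact: IH (leq_trans lt Bm) HB'.
Qed.

(** All deviations in a column have one sign, so their absolute values add up to that of their
    sum. *)
Lemma margins_l1 B : margins_inv B ->
  \sum_k \sum_j `|B k j 0 - c k j| = l1norm (csum (\sum_k P k) - b).
Proof.
move=> [bs _ up lo]; rewrite exchange_big l1norm_cV; apply: eq_bigr => j _.
have -> : (csum (\sum_k P k) - b) j 0 = ctot j - b j 0.
  by move: (csum _) => X; rewrite !mxE.
have S : \sum_k (B k j 0 - c k j) = b j 0 - ctot j by rewrite sumrB bs ctotE.
have [H|/ltW H] := leP (ctot j) (b j 0).
  under eq_bigr do rewrite ger0_norm ?subr_ge0 ?up//.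
  by rewrite S distrC ger0_norm ?subr_ge0.
under eq_bigr do rewrite ler0_norm ?subr_le0 ?lo// .
by rewrite sumrN S opprB ger0_norm ?subr_ge0.
Qed.

End Margins.

(** * Rounding a plan to prescribed margins *)

Section Round.
Context {R : realType} {n : nat}.
Variables (P : 'M[R]_n) (B : 'cV[R]_n).
Hypotheses (n0 : (0 < n)%N) (P0 : forall i j, 0 < P i j).
Hypothesis B0 : forall j, 0 <= B j 0.
Hypothesis mass : \sum_j B j 0 = \sum_j csum P j 0.
Local Notation c j := (csum P j 0).
Local Notation Q := (round_plan P (rsum P) B).

Let c0 j : 0 < c j.
Proof.
rewrite csumE (bigD1 (Ordinal n0))//= ltr_pwDl// sumr_ge0// => i _.
exact/ltW.
Qed.

Let r0 i : 0 < rsum P i 0.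
Proof.
rewrite rsumE (bigD1 (Ordinal n0))//= ltr_pwDl// sumr_ge0// => j _.
exact/ltW.
Qed.

(** The row target is the row sums of P itself, so the row scaling is the identity and only the
    column scaling [s] remains; [ea] and [eb] are the residuals, of common mass [e]. *)
Let s j := Num.min (B j 0 / c j) 1.
Let ea i := rsum P i 0 - \sum_j P i j * s j.
Let eb j := B j 0 - c j * s j.
Let e := \sum_i ea i.

Let cs j : c j * s j = Num.min (B j 0) (c j).
Proof.
by rewrite /s minr_pMr ?ltW// mulr1 mulrC divfK// gt_eqF.
Qed.

Let s1 j : s j <= 1. Proof. by rewrite ge_min lexx orbT. Qed.
Let s0 j : 0 <= s j. Proof. by rewrite le_min ler01 divr_ge0// ltW. Qed.

Let ea0 i : 0 <= ea i.
Proof.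
rewrite subr_ge0 rsumE; apply: ler_sum => j _.
by rewrite ler_piMr// ltW.
Qed.

Let eb0 j : 0 <= eb j.
Proof. by rewrite subr_ge0 cs ge_min lexx. Qed.

Let sum_P2 : \sum_i \sum_j P i j * s j = \sum_j c j * s j.
Proof.
rewrite exchange_big; apply: eq_bigr => j _ /=.
by rewrite csumE mulr_suml.
Qed.

Let sum_rsum_csum : \sum_i rsum P i 0 = \sum_j c j.
Proof.
under eq_bigr do rewrite rsumE.
by rewrite exchange_big; apply: eq_bigr => j _; rewrite csumE.
Qed.

Let eE : e = \sum_j eb j.
Proof. by rewrite /e /ea /eb !sumrB sum_P2 mass sum_rsum_csum. Qed.

Lemma round_planE i j : Q i j = P i j * s j + e^-1 * (ea i * eb j).
Proof.
rewrite /round_plan.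
have -> : diag_mx (\col_i0 Num.min (rsum P i0 0 / rsum P i0 0) 1)^T *m P = P.
  apply/matrixP => k l; rewrite mul_diag_mx mxE [X in X * _]mxE [X in X * _]mxE.
  by rewrite divff ?gt_eqF// minxx mul1r.
set P2 := P *m _.
have P2E k l : P2 k l = P k l * s l.
  by rewrite /P2 mul_mx_diag mxE [X in _ * X]mxE [X in _ * X]mxE.
have eaE : rsum P - rsum P2 = \col_k ea k.
  apply/matrixP => k l; rewrite [l]ord1 [RHS]mxE /ea.
  under [in RHS]eq_bigr do rewrite -P2E.
  by rewrite -rsumE; move: (rsum P) (rsum P2) => X Y; rewrite !mxE.
have ebE : B - csum P2 = \col_k eb k.
  apply/matrixP => k l; rewrite [l]ord1 [RHS]mxE /eb csumE mulr_suml.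
  under [in RHS]eq_bigr do rewrite -P2E.
  by rewrite -csumE; move: (csum P2) => Y; rewrite !mxE.
rewrite eaE ebE.
have -> : l1norm (\col_k ea k) = e.
  by rewrite l1norm_cV; apply: eq_bigr => k _; rewrite mxE ger0_norm.
by rewrite mxE P2E [X in _ + X]mxE mxE big_ord1 !mxE.
Qed.

Lemma round_plan_ge0 i j : 0 <= Q i j.
Proof.
rewrite round_planE addr_ge0//.
  by rewrite mulr_ge0// ltW.
by rewrite mulr_ge0 ?invr_ge0 ?sumr_ge0// mulr_ge0.
Qed.

(** For e = 0 the nonnegative residuals all vanish, which makes the convention 0^-1 = 0 harmless. *)
Let e_div (t : R) : (e = 0 -> t = 0) -> e^-1 * (t * e) = t.
Proof.
have [/[swap] /[apply] ->|en _] := eqVneq e 0; first by rewrite mul0r mulr0.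
by rewrite mulrCA mulVf// mulr1.
Qed.

Lemma rsum_round_plan : rsum Q = rsum P.
Proof.
apply/matrixP => i j; rewrite [j]ord1 rsumE {j}.
under eq_bigr do rewrite round_planE.
rewrite big_split/= -mulr_sumr -mulr_sumr -eE e_div /ea ?subrKC//.
move=> e0; have /psumr_eq0P := e0; exact.
Qed.

Lemma csum_round_plan : csum Q = B.
Proof.
apply/matrixP => j i; rewrite [i]ord1 csumE {i}.
under eq_bigr do rewrite round_planE.
rewrite big_split/= -mulr_sumr -mulr_suml -/e mulrC -mulr_suml -csumE.
rewrite (mulrC e) mulrC e_div /eb ?subrKC//.
by rewrite eE => /psumr_eq0P; exact.
Qed.

(** Scaling removes mass e and the rank-one term adds mass e, while the l1-distance of B and c is 2
    e because their totals agree. *)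
Lemma round_plan_l1 :
  \sum_i \sum_j `|Q i j - P i j| <= \sum_j `|B j 0 - c j|.
Proof.
have -> : \sum_j `|B j 0 - c j| = e + e.
  rewrite {1}/e eE {1}/ea sumrB sum_P2 sum_rsum_csum -sumrB -big_split /=.
  apply: eq_bigr => j _; rewrite /eb cs.
  case: leP => [H|/ltW H]; first by rewrite ler0_norm ?subr_le0//; lra.
  by rewrite ger0_norm ?subr_ge0//; lra.
apply: (@le_trans _ _ (\sum_i \sum_j (P i j * (1 - s j) + e^-1 * (ea i * eb j)))).
  apply: ler_sum => i _; apply: ler_sum => j _; rewrite round_planE.
  have h1 : 0 <= P i j * (1 - s j) by rewrite mulr_ge0 ?subr_ge0// ltW.
  have h2 : 0 <= e^-1 * (ea i * eb j).
    by rewrite mulr_ge0 ?invr_ge0 ?sumr_ge0// mulr_ge0.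
  by rewrite ler_norml; lra.
rewrite le_eqVlt; apply/orP; left; apply/eqP.
under eq_bigr do rewrite big_split/= -!mulr_sumr -eE.
rewrite big_split/=; congr (_ + _).
  rewrite /e /ea; apply: eq_bigr => i _; rewrite rsumE -sumrB.
  by apply: eq_bigr => j _; rewrite mulrBr mulr1.
by rewrite -mulr_sumr -mulr_suml e_div.
Qed.

End Round.

(** * One iteration: descent, dual gap and gap after rounding *)

Section Iteration.
Context {R : realType} {n N : nat}.
Variables (eps theta : R) (a b : 'cV[R]_n) (C : 'I_N -> 'M[R]_n).
Hypotheses (n0 : (0 < n)%N) (N0 : (0 < N)%N).
Hypotheses (eta0 : 0 < eta eps C) (eta_le : eta eps C <= cinf C).
Hypotheses (theta01 : 0 < theta < 1).
Hypotheses (sa : simplex a) (sb : simplex b).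
Hypotheses (a0 : forall i, 0 < a i 0) (b0 : forall j, 0 < b j 0).
Local Notation eta := (eta eps C).
Local Notation cinf := (cinf C).
Local Notation gibbs := (gibbs eps C).
Local Notation zeta := (zeta eps C).
Local Notation dualF := (dualF eps a b C).
Local Notation logit := (logit eps C).
Local Notation cell := ('I_N * 'I_n * 'I_n)%type.
Local Notation L := (cinf ^+ 2 / eta).

Let c0 : 0 < cinf := lt_le_trans eta0 eta_le.
Let L0 : 0 < L. Proof. by rewrite divr_gt0// exprn_gt0. Qed.
Let cL : cinf <= L.
Proof. by rewrite ler_pdivlMr// expr2 ler_wpM2l// ltW. Qed.

Lemma sum_gradient_le (f g f' g' : 'cV[R]_n) (l l' : 'cV[R]_N) (d : 'I_N -> R) D :
  (forall k, `|d k| <= D) ->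
  \sum_k d k * inner (gibbs f g l k) (C k) - \sum_k d k * inner (gibbs f' g' l' k) (C k)
    <= cinf * D * \sum_u `|softmax (logit f g l) u - softmax (logit f' g' l') u|.
Proof.
move=> dD; rewrite !sum_inner -sumrB mulr_sumr; apply: ler_sum => -[[k i] j] _ /=.
rewrite !gibbsE// -mulrBr -mulrBl mulrCA mulrC.
rewrite (le_trans (ler_norm _))// !normrM ler_wpM2r// mulrC.
by rewrite ler_pM ?cinf_ge.
Qed.

Lemma sum_gradient_le_cinf (f g : 'cV[R]_n) (l : 'cV[R]_N) (d : 'I_N -> R) D :
  (forall k, `|d k| <= D) ->
  \sum_k d k * inner (gibbs f g l k) (C k) <= cinf * D.
Proof.
pose u0 : cell := (Ordinal N0, Ordinal n0, Ordinal n0).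
move=> dD; rewrite sum_inner -[leRHS]mulr1 -(sum_softmax u0 (logit f g l)).
rewrite mulr_sumr; apply: ler_sum => -[[k i] j] _ /=.
rewrite gibbsE// mulrCA mulrC ler_wpM2r ?(ltW (softmax_gt0 u0 _ _))//.
by rewrite (le_trans (ler_norm _))// normrM mulrC ler_pM ?cinf_ge.
Qed.

(** Here [f], [g], [l], [lp] stand for f^(t+1), g^t, lambda^t, lambda^(t-1), and below [g'], [y],
    [l'] stand for g^(t+1), y^(t+1), lambda^(t+1). *)
Variables (f g : 'cV[R]_n) (l lp : 'cV[R]_N).
Hypotheses (sl : simplex l) (slp : simplex lp).
Hypothesis row_fit : rsum (\sum_k zeta f g l k) = a.

Variables (g' : 'cV[R]_n) (y l' : 'cV[R]_N) (x u v : R).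
Hypothesis g'E : g' = col_update eps b C f g l.
Hypothesis yE : y = proj_simplex (l + (1 - theta) *: (l - lp)).
Hypothesis l'E : l' = proj_simplex (y + tau eps C *: gradient (dualF f g') y).
Hypothesis xE : x = l1norm (csum (\sum_k gibbs f g l k) - b).
Hypothesis uE : u = l2norm (l - lp).
Hypothesis vE : v = l2norm (l' - y).

Let mass1 : \sum_c expR (logit f g l c) = 1.
Proof. exact: mass_rsum row_fit. Qed.
Let sl' : simplex l'. Proof. by rewrite l'E; exact: (proj_simplexP _ N0).1. Qed.
Let u_ge0 : 0 <= u. Proof. by rewrite uE l2norm_ge0. Qed.
Let v_ge0 : 0 <= v. Proof. by rewrite vE l2norm_ge0. Qed.
Let l'_y k : `|l' k 0 - y k 0| <= v.
Proof. by rewrite vE; have := entry_le_l2norm (l' - y) k; rewrite !mxE. Qed.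

Let y_l : l2norm (y - l) <= (1 - theta) * u.
Proof.
have /le_trans := proj_simplex_l2_le (l + (1 - theta) *: (l - lp)) N0 sl.
rewrite -yE => /(_ ((1 - theta) * u)); apply.
rewrite addrC addKr l2normZ -uE ger0_norm//.
by case/andP: theta01 => _ /ltW; rewrite subr_ge0.
Qed.

(** The variational inequality of the projection defining [l'], multiplied by 1 / tau = 2 L. *)
Let prox_step z : simplex z ->
  \sum_k (z k 0 - l' k 0) * inner (gibbs f g' y k) (C k)
    <= 2 * L * \sum_k (l' k 0 - y k 0) * (z k 0 - l' k 0).
Proof.
move=> sz.
have [_ /(_ _ sz)] := proj_simplexP (y + tau eps C *: gradient (dualF f g') y) N0.
rewrite -l'E => H.
have tau0 : 0 < tau eps C by rewrite divr_gt0// mulr_gt0// exprn_gt0.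
rewrite -(ler_pM2l tau0).
have -> : tau eps C * (2 * L * \sum_k (l' k 0 - y k 0) * (z k 0 - l' k 0))
    = \sum_k (l' k 0 - y k 0) * (z k 0 - l' k 0).
  by rewrite /tau; set s := \sum_k _; field; rewrite !gt_eqF.
rewrite -subr_le0 mulr_sumr -sumrB; apply: le_trans H.
rewrite le_eqVlt; apply/orP; left; apply/eqP; apply: eq_bigr => k _.
have -> : (y + tau eps C *: gradient (dualF f g') y) k 0
    = y k 0 + tau eps C * inner (gibbs f g' y k) (C k).
  by rewrite mxE [X in _ + X]mxE gradient_dualF.
ring.
Qed.

(** The column step gains eta/2 x^2. For lambda, concavity and smoothness at y are combined with
    [prox_step] at z = l: by the three-point identity [E2] the loss is at most L |y - l|^2 - L/2 v^2
    - L |l' - l|^2, where |y - l| <= (1 - theta) u and 1 - (1 - theta)^2 = 2 theta - theta^2. *)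
Lemma pame_descent :
  dualF f g l - L * u ^+ 2 + (eta / 2 * x ^+ 2
      + L * (2 * theta - theta ^+ 2) * u ^+ 2 + L / 2 * v ^+ 2)
    <= dualF f g' l' - L * l2norm (l' - l) ^+ 2.
Proof.
have col : dualF f g l <= dualF f g' l - eta / 2 * x ^+ 2.
  have := dualF_col_update a n0 N0 eta0 sb b0 f g l.
  by rewrite col_update_l1// -g'E -xE.
have conc : dualF f g' l <= dualF f g' y
    + \sum_k (l k 0 - y k 0) * inner (gibbs f g' y k) (C k).
  have := dualF_le a b n0 N0 eta0 f g' y f g' l.
  rewrite [X in _ + X + _ + _ - _]big1 => [|i _]; last by rewrite subrr mul0r.
  rewrite [X in _ + _ + X + _ - _]big1 => [|i _]; last by rewrite subrr mul0r.
  rewrite !addr0 => /le_trans; apply; rewrite gerBl.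
  by rewrite mulr_ge0 ?sqr_ge0// divr_ge0 ?ltW.
have smooth : dualF f g' y
    + \sum_k (l' k 0 - y k 0) * inner (gibbs f g' y k) (C k)
    - L / 2 * v ^+ 2 <= dualF f g' l'.
  exact: dualF_lambda_ge.
have := prox_step sl.
have E1 : \sum_k (l k 0 - l' k 0) * inner (gibbs f g' y k) (C k)
   = \sum_k (l k 0 - y k 0) * inner (gibbs f g' y k) (C k)
   - \sum_k (l' k 0 - y k 0) * inner (gibbs f g' y k) (C k).
  by rewrite -sumrB; apply: eq_bigr => k _; ring.
have E2 : 2 * \sum_k (l' k 0 - y k 0) * (l k 0 - l' k 0)
    = l2norm (y - l) ^+ 2 - v ^+ 2 - l2norm (l' - l) ^+ 2.
  rewrite vE !sqr_l2norm -!sumrB mulr_sumr; apply: eq_bigr => k _.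
  by rewrite !mxE; ring.
rewrite E1 mulrAC E2 [X in _ <= X]mulrC => prox.
have yl2 : l2norm (y - l) ^+ 2 <= (1 - theta) ^+ 2 * u ^+ 2.
  by rewrite -exprMn ler_pXn2r ?nnegrE ?l2norm_ge0// (le_trans _ y_l)// l2norm_ge0.
have := ler_wpM2l (ltW L0) yl2.
move: col conc smooth prox.
lra.
Qed.

(** Moving the gradient from (f, g, l) to (f, g', y) costs cinf x + L (1 - theta) u. At y, the
    direction mu - l is split at l': [prox_step] bounds the first part by 4 L v, and the second has
    entries of size at most v + (1 - theta) u, with cinf <= L. *)
Lemma sum_gradient_gap mu : simplex mu ->
  \sum_k (mu k 0 - l k 0) * inner (gibbs f g l k) (C k)
    <= cinf * x + L * (2 * (1 - theta) * u + 5 * v).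
Proof.
move=> smu; pose d k := mu k 0 - l k 0.
have d1 k : `|d k| <= 1 by exact: simplex_entryB_le1.
have S1 := sum_gradient_le f g f g' l l d1.
have px : \sum_c `|softmax (logit f g l) c - softmax (logit f g' l) c| = x.
  by under eq_bigr do rewrite distrC; rewrite g'E col_update_l1.
rewrite mulr1 px in S1.
have yl k : `|y k 0 - l k 0| <= (1 - theta) * u.
  by apply: le_trans y_l; have := entry_le_l2norm (y - l) k; rewrite !mxE.
have S2 := sum_gradient_le f g' f g' l y d1.
rewrite mulr1 in S2.
have {}S2 : \sum_k d k * inner (gibbs f g' l k) (C k)
    - \sum_k d k * inner (gibbs f g' y k) (C k) <= L * ((1 - theta) * u).
  apply: (le_trans S2).
  under eq_bigr do rewrite distrC.
  have -> : L * ((1 - theta) * u) = cinf * (cinf / eta * ((1 - theta) * u)).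
    by field; rewrite gt_eqF.
  by rewrite ler_pM2l// softmax_lambda_l1.
have S3 := prox_step smu.
have S3' : \sum_k (l' k 0 - y k 0) * (mu k 0 - l' k 0) <= v * 2.
  have := simplex_l1_le2 smu sl' => /(ler_wpM2l v_ge0); apply: le_trans.
  rewrite mulr_sumr; apply: ler_sum => k _.
  by rewrite (le_trans (ler_norm _))// normrM ler_wpM2r.
have S4 : \sum_k (l' k 0 - l k 0) * inner (gibbs f g' y k) (C k)
    <= cinf * (v + (1 - theta) * u).
  apply: sum_gradient_le_cinf => k.
  have -> : l' k 0 - l k 0 = (l' k 0 - y k 0) + (y k 0 - l k 0) by ring.
  by rewrite (le_trans (ler_normD _ _))// lerD.
have E : \sum_k d k * inner (gibbs f g' y k) (C k)
    = \sum_k (mu k 0 - l' k 0) * inner (gibbs f g' y k) (C k)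
    + \sum_k (l' k 0 - l k 0) * inner (gibbs f g' y k) (C k).
  by rewrite -big_split; apply: eq_bigr => k _ /=; rewrite /d; ring.
have L2 : 0 <= 2 * L by rewrite mulr_ge0// ltW.
have := ler_wpM2l L2 S3'.
have vu0 : 0 <= v + (1 - theta) * u.
  by rewrite addr_ge0// mulr_ge0//; case/andP: theta01; lra.
have := ler_wpM2r vu0 cL.
rewrite -/(d _); move: S1 S2 S3 S4; rewrite E.
lra.
Qed.

Variable w : R.
Hypothesis g_osc : forall j j', g j 0 - g j' 0 <= w.
Hypothesis w_def : w = 2 * cinf - eta * iota_b b.

(** Concavity at (f, g, l): the f-part vanishes since the rows fit, two potentials of oscillation w
    bound the g-part by w x, and [sum_gradient_gap] bounds the lambda-part. *)
Lemma dual_gap_le fs gs ls : dual_maximizer eps a b C fs gs ls ->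
  dualF fs gs ls - dualF f g l + L * u ^+ 2
    <= (w + cinf) * x + L * ((4 - 2 * theta) * u + 5 * v).
Proof.
move=> [sls Fmax]; pose gs' := col_update eps b C fs gs ls.
(* Replacing gs by its column update keeps a maximizer and bounds its oscillation. *)
have colmax : dualF fs gs ls <= dualF fs gs' ls.
  apply: le_trans (dualF_col_update a n0 N0 eta0 sb b0 fs gs ls) _.
  by rewrite gerBl mulr_ge0 ?sqr_ge0// divr_ge0 ?ltW.
have gs'_osc j j' : gs' j 0 - gs' j' 0 <= w.
  by rewrite w_def; apply: col_potential_osc sls => //; exact: csum_col_update.
have c1 : \sum_j csum (\sum_k zeta f g l k) j 0 = 1.
  have := sum_csum (zeta f g l) (fun=> 1).
  under eq_bigr do rewrite mul1r.
  move=> ->; rewrite -[RHS]mass1; apply: eq_bigr => -[[k i] j] _ /=.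
  by rewrite mul1r zetaE.
have gz : gibbs f g l = zeta f g l by exact: gibbs_zeta.
have B : \sum_j (gs' j 0 - g j 0) * (b j 0 - csum (\sum_k gibbs f g l k) j 0)
    <= w * x.
  have -> : w * x = (w + w) / 2 * x by field.
  have -> : x = \sum_j `|b j 0 - csum (\sum_k gibbs f g l k) j 0|.
    by rewrite xE l1norm_cV; apply: eq_bigr => j _; rewrite !mxE distrC.
  under eq_bigr do rewrite mulrC.
  apply: sum_osc_le => // [|j j'].
    by rewrite sumrB sb.2 gz c1 subrr.
  by have := gs'_osc j j'; have := g_osc j' j; lra.
have := dualF_le a b n0 N0 eta0 f g l fs gs' ls.
rewrite [X in _ + X + _ + _ - _]big1 => [|i _]; last first.
  by rewrite gz row_fit subrr mulr0.
set t2 := (\sum_u `|_|) ^+ 2.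
have t20 : 0 <= eta / 2 * t2 by rewrite mulr_ge0 ?sqr_ge0// divr_ge0 ?ltW.
have G := sum_gradient_gap sls.
(* The l2-diameter of the simplex is at most 2, so L u^2 <= 2 L u, which turns 2 (1 - theta) u into
   (4 - 2 theta) u. *)
have u2 : u <= 2 by rewrite uE; exact: simplex_l2B_le2.
have : L * u ^+ 2 <= L * (2 * u).
  by rewrite ler_pM2l// expr2 ler_wpM2r.
move: B G colmax; lra.
Qed.

Let gz : gibbs f g l = zeta f g l.
Proof. exact: gibbs_zeta. Qed.

Let P := gibbs f g l.

Let P_gt0 k i j : 0 < P k i j.
Proof. by rewrite /P gz zetaE expR_gt0. Qed.

Let P_mass : \sum_j csum (\sum_k P k) j 0 = \sum_j b j 0.
Proof.
have := sum_csum P (fun=> 1).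
under eq_bigr do rewrite mul1r.
move=> ->; rewrite sb.2 -[RHS]mass1; apply: eq_bigr => -[[k i] j] _ /=.
by rewrite mul1r /P gz zetaE.
Qed.

Lemma rsum_sum (Q : 'I_N -> 'M[R]_n) : rsum (\sum_k Q k) = \sum_k rsum (Q k).
Proof. by rewrite /rsum mulmx_suml. Qed.

Lemma csum_sum (Q : 'I_N -> 'M[R]_n) : csum (\sum_k Q k) = \sum_k csum (Q k).
Proof. by rewrite /csum linear_sum mulmx_suml. Qed.

Lemma round_coupling B : margins P b B ->
  couplings a b (fun k => round_plan (P k) (rsum (P k)) (B k)).
Proof.
move=> [/(margins_reach_inv P_gt0 N0 P_mass)[bs cs _ _] B0].
split=> [k i j||].
- exact: round_plan_ge0 n0 (P_gt0 k) (B0 k) i j.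
- rewrite rsum_sum -row_fit -gz -/P rsum_sum.
  by apply: eq_bigr => k _; rewrite (rsum_round_plan n0 (P_gt0 k) (cs k)).
- apply/matrixP => j i; rewrite [i]ord1 csum_sum summxE -bs.
  by apply: eq_bigr => k _; rewrite (csum_round_plan n0 (P_gt0 k) (cs k)).
Qed.

Lemma ell_round_le B mu : margins P b B -> simplex mu ->
  ell C (fun k => round_plan (P k) (rsum (P k)) (B k)) mu
    <= ell C P mu + cinf * x.
Proof.
move=> [/(margins_reach_inv P_gt0 N0 P_mass) Binv B0] smu.
rewrite -lerBlDl /ell !sum_inner -sumrB xE -(margins_l1 Binv) mulr_sumr.
have [_ cs _ _] := Binv.
apply: (@le_trans _ _ (\sum_k cinf *
    \sum_i \sum_j `|round_plan (P k) (rsum (P k)) (B k) i j - P k i j|)).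
  rewrite -mulr_sumr sum_triple mulr_sumr; apply: ler_sum => -[[k i] j] _ /=.
  rewrite -mulrBr -mulrBl mulrCA mulrC.
  apply: le_trans (ler_norm _) _; rewrite !normrM ler_wpM2r// -[leRHS]mul1r.
  by rewrite ler_pM ?cinf_ge// ger0_norm ?simplex_le1//; exact: smu.1.
apply: ler_sum => k _; apply: (ler_wpM2l (ltW c0)).
exact: round_plan_l1 n0 (P_gt0 k) (cs k).
Qed.

(** Weak duality: each entry of [zeta] is at most the total mass 1, so f_i + g_j <= lambda_k C^k_ij,
    to be integrated against Q. *)
Lemma ell_coupling_ge Q : couplings a b Q ->
  \sum_i f i 0 * a i 0 + \sum_j g j 0 * b j 0 <= ell C Q l.
Proof.
move=> [Q0 ra cb].
rewrite -[in X in X + _]ra -[in X in _ + X]cb (sum_rsum _ (fun i => f i 0)).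
rewrite (sum_csum _ (fun j => g j 0)) /ell (sum_inner _ _ (fun k => l k 0)).
rewrite -big_split; apply: ler_sum => -[[k i] j] _ /=.
have : logit f g l (k, i, j) <= 0.
  rewrite -ler_expR expR0 -mass1 (bigD1 (k, i, j))//= lerDl.
  by rewrite sumr_ge0// => c _; exact: expR_ge0.
rewrite /logit /= ler_pdivrMr// mul0r => H.
have := mulr_ge0_le0 (Q0 k i j) H; lra.
Qed.

(** The cost of the Gibbs plan is the integral of its potentials plus eta times its entropy;
    replacing its column sums by b costs at most w/2 x. *)
Lemma ell_gibbs_le :
  ell C P l <= \sum_i f i 0 * a i 0 + \sum_j g j 0 * b j 0
    + eta * ln (n ^ 2 * N)%:R + w / 2 * x.
Proof.
pose u0 : cell := (Ordinal N0, Ordinal n0, Ordinal n0).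
have ent : - \sum_c softmax (logit f g l) c * logit f g l c <= ln (n ^ 2 * N)%:R.
  (* The zero logit is the uniform distribution; nonnegativity of the divergence from it is the
     entropy bound. *)
  have := lse_bregman_ge u0 (logit f g l) (fun=> 0).
  rewrite [X in _ <= X - _ - _]/lse expR0 sumr_const.
  have -> : lse (logit f g l) = 0 by rewrite /lse mass1 ln1.
  rewrite !card_prod !card_ord subr0 => H.
  have {}H := le_trans (divr_ge0 (sqr_ge0 _) (ltW (ltr0Sn R 1))) H.
  have S : \sum_c softmax (logit f g l) c * (0 - logit f g l c)
      = - \sum_c softmax (logit f g l) c * logit f g l c.
    by rewrite -sumrN; apply: eq_bigr => c _; rewrite sub0r mulrN.
  have -> : (n ^ 2 * N = N * n * n)%N by rewrite mulnC -mulnn mulnA.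
  by move: H; rewrite S subr_ge0.
have E : ell C P l = \sum_i f i 0 * a i 0
    + \sum_j g j 0 * csum (\sum_k P k) j 0
    - eta * \sum_c softmax (logit f g l) c * logit f g l c.
  rewrite -row_fit -gz (sum_rsum _ (fun i => f i 0)).
  rewrite (sum_csum _ (fun j => g j 0)) /ell (sum_inner _ _ (fun k => l k 0)).
  rewrite mulr_sumr -big_split -sumrB; apply: eq_bigr => -[[k i] j] _ /=.
  rewrite /P gibbsE//; set p := softmax _ _.
  by rewrite /logit /=; field; rewrite gt_eqF.
have B : \sum_j g j 0 * csum (\sum_k P k) j 0 - \sum_j g j 0 * b j 0
    <= w / 2 * x.
  have -> : x = \sum_j `|csum (\sum_k P k) j 0 - b j 0|.
    rewrite xE l1norm_cV -/P; apply: eq_bigr => j _.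
    by move: (csum _) => X; rewrite !mxE.
  rewrite -sumrB; under eq_bigr do rewrite -mulrBr mulrC.
  by apply: sum_osc_le => //; rewrite sumrB P_mass subrr.
have := ler_wpM2l (ltW eta0) ent.
rewrite E; lra.
Qed.

(** The gap is at most the sum of the entropy term, of L (2 (1 - theta) u + 5 v) and of (2 cinf +
    w/2) x, where 2 cinf + w/2 is half of 6 cinf - eta iota; the thresholds keep this sum at most
    eps. *)
Lemma rounded_gap :
  eta * ln (n ^ 2 * N)%:R <= eps / 3 ->
  x <= eps / (6 * (6 * cinf - eta * iota_b b)) ->
  u <= eta * eps / (60 * (1 - theta) * cinf ^+ 2) ->
  v <= eta * eps / (42 * cinf ^+ 2) ->
  rounded_eps_optimal eps a b C P l.
Proof.
move=> entE xs us vs; split; first exact: margins_exists P_gt0 b0 N0 P_mass.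
move=> B HB; have cB := round_coupling HB; split=> //.
have th1 : 0 < 1 - theta by rewrite subr_gt0; case/andP: theta01.
have z0 : 0 < 6 * cinf - eta * iota_b b.
  have : eta * iota_b b <= 0 by rewrite mulr_ge0_le0 ?iota_b_le0// ltW.
  by have := c0; lra.
have Lu : L * ((1 - theta) * u) <= eps / 60.
  move: us; rewrite -(ler_pM2l th1) -(ler_pM2l L0) => /le_trans; apply.
  by rewrite le_eqVlt; apply/orP; left; apply/eqP; field; rewrite !gt_eqF.
have Lv : L * v <= eps / 42.
  move: vs; rewrite -(ler_pM2l L0) => /le_trans; apply.
  by rewrite le_eqVlt; apply/orP; left; apply/eqP; field; rewrite !gt_eqF.
have Xz : (6 * cinf - eta * iota_b b) * x <= eps / 6.
  move: xs; rewrite -(ler_pM2l z0) => /le_trans; apply.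
  by rewrite le_eqVlt; apply/orP; left; apply/eqP; field; rewrite !gt_eqF.
(* The sign of eps is read off from 0 <= L v <= eps / 42. *)
have eps0 : 0 <= eps.
  by have := mulr_ge0 (ltW L0) v_ge0; move: Lv; lra.
have gap mu Q : simplex mu -> couplings a b Q ->
    ell C (fun k => round_plan (P k) (rsum (P k)) (B k)) mu - ell C Q l <= eps.
  move=> smu cQ.
  have h1 := ell_round_le HB smu.
  have h2 := sum_gradient_gap smu.
  have h3 := ell_gibbs_le.
  have h4 := ell_coupling_ge cQ.
  have h5 : ell C P mu - ell C P l
      = \sum_k (mu k 0 - l k 0) * inner (gibbs f g l k) (C k).
    by rewrite /ell -sumrB; apply: eq_bigr => k _; rewrite mulrBl.
  move: h1 h2 h3 h4 h5 Lu Lv Xz entE eps0; rewrite w_def.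
  move: (ell C _ mu) (ell C P mu) (ell C P l) (ell C Q l) => e1 e2 e3 e4.
  move: (\sum_k _) (\sum_i _) (\sum_j _) => s1 s2 s3.
  lra.
(* The bound for all pairs passes to the supremum and the infimum, both over nonempty sets: [l] and
   the rounded plan itself are members. *)
rewrite lerBlDr; apply: ge_sup.
  by exists (ell C (fun k => round_plan (P k) (rsum (P k)) (B k)) l), l.
move=> _ [mu smu <-]; rewrite -lerBlDl; apply: lb_le_inf.
  pose Q k := round_plan (P k) (rsum (P k)) (B k).
  by exists (ell C Q l), Q.
by move=> _ [Q cQ <-]; have := gap mu Q smu cQ; lra.
Qed.

End Iteration.

(** * Convergence rate for real sequences *)

Section Rate.
Context {R : realType}.

Lemma cauchy_schwarz3 (A B C x y z p q r : R) : 0 < p -> 0 < q -> 0 < r ->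
  (A * x + B * y + C * z) ^+ 2 <=
  (A ^+ 2 / p + B ^+ 2 / q + C ^+ 2 / r)
  * (p * x ^+ 2 + q * y ^+ 2 + r * z ^+ 2).
Proof.
have cross (A' B' x' y' p' q' : R) : 0 < p' -> 0 < q' ->
    0 <= A' ^+ 2 / p' * (q' * y' ^+ 2) + B' ^+ 2 / q' * (p' * x' ^+ 2)
         - 2 * (A' * x') * (B' * y').
  move=> p0 q0; have -> : A' ^+ 2 / p' * (q' * y' ^+ 2)
      + B' ^+ 2 / q' * (p' * x' ^+ 2) - 2 * (A' * x') * (B' * y')
      = (A' * q' * y' - B' * p' * x') ^+ 2 / (p' * q').
    by field; rewrite !gt_eqF.
  by rewrite divr_ge0 ?sqr_ge0// mulr_ge0// ltW.
move=> p0 q0 r0.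
have := cross A B x y p q p0 q0; have := cross A C x z p r p0 r0.
have := cross B C y z q r q0 r0.
move=> h1 h2 h3; rewrite -subr_ge0.
have -> : (A ^+ 2 / p + B ^+ 2 / q + C ^+ 2 / r)
  * (p * x ^+ 2 + q * y ^+ 2 + r * z ^+ 2) - (A * x + B * y + C * z) ^+ 2
  = (A ^+ 2 / p * (q * y ^+ 2) + B ^+ 2 / q * (p * x ^+ 2)
       - 2 * (A * x) * (B * y))
  + (A ^+ 2 / p * (r * z ^+ 2) + C ^+ 2 / r * (p * x ^+ 2)
       - 2 * (A * x) * (C * z))
  + (B ^+ 2 / q * (r * z ^+ 2) + C ^+ 2 / r * (q * y ^+ 2)
       - 2 * (B * y) * (C * z)).
  by field; rewrite !gt_eqF.
exact: addr_ge0 (addr_ge0 h3 h2) h1.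
Qed.

(** From G_(t+1) <= G_t (1 - G_t / K) and t G_t <= K one gets (t + 1) G_t (K - G_t) <= (K + G_t) (K
    - G_t) <= K^2 if G_t <= K; otherwise the left-hand side is nonpositive. *)
Lemma quadratic_decrease (G D : nat -> R) (K : R) : 0 < K ->
  (forall t, 0 <= G t) -> (forall t, G t.+1 <= G t - D t) ->
  (forall t, G t ^+ 2 <= K * D t) ->
  forall t, t%:R * G t <= K.
Proof.
move=> K0 G0 GD GK; elim=> [|t IH]; first by rewrite mul0r ltW.
have GG : K * G t.+1 <= G t * (K - G t).
  by have := GK t; have := ler_wpM2l (ltW K0) (GD t); rewrite mulrBr; lra.
have KG : 0 <= K - G t \/ K - G t < 0 by case: (leP 0 (K - G t)); auto.
rewrite -(ler_pM2l K0) -natr1 mulrCA.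
apply: (@le_trans _ _ ((t%:R + 1) * (G t * (K - G t)))).
  by rewrite ler_wpM2l// addr_ge0.
case: KG => [KG|KG].
  have : (t%:R * G t) * (K - G t) <= K * (K - G t) by rewrite ler_wpM2r.
  by have := sqr_ge0 (G t); lra.
apply: (@le_trans _ _ 0); last by rewrite mulr_ge0// ltW.
by rewrite mulr_ge0_le0 ?addr_ge0// mulr_ge0_le0// ltW.
Qed.

(** Here [h] stands for eta, [c] for cinf, [z] for 6 cinf - eta iota and [W] for gamma1^(-1/2); the
    three upper bounds by W express the three terms of the minimum [gamma1]. *)
Variables (eps theta h c w z W : R).
Hypotheses (eps0 : 0 < eps) (theta01 : 0 < theta < 1) (h0 : 0 < h) (c0 : 0 < c).
Hypotheses (w_ge : 2 * c <= w) (z_def : z = w + 4 * c).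
Hypotheses (W0 : 0 < W) (wW : w <= W) (cW : 7 * c <= W).
Hypothesis thetaW :
  (7 - 5 * theta) ^+ 2 * c ^+ 2 <= 2 * (2 * theta - theta ^+ 2) * W ^+ 2.

Variables (G x u v : nat -> R).
Hypotheses (x0 : forall t, 0 <= x t) (u0 : forall t, 0 <= u t).
Hypotheses (v0 : forall t, 0 <= v t) (G0 : forall t, 0 <= G t).

Let kap := 2 * theta - theta ^+ 2.
Let D t := h / 2 * x t ^+ 2 + c ^+ 2 / h * kap * u t ^+ 2
           + c ^+ 2 / h / 2 * v t ^+ 2.

Hypothesis GD : forall t, G t.+1 <= G t - D t.
Hypothesis G_le : forall t, G t <= (w + c) * x t
  + c ^+ 2 / h * ((4 - 2 * theta) * u t + 5 * v t).

(** G^2 <= (M / h) D always holds, and an iteration that is not small has D >= h eps^2 / Y. Since 6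
    M + Y / 6 <= 48 (z W + W^2), the two phases of the count yield the constants 48. *)
Let M := 16 / 7 * (z * W) + (2 + 50 / 49) * W ^+ 2.
Let Y := 114 * (z * W) + 147 * W ^+ 2.

Let kap0 : 0 < kap.
Proof.
case/andP: theta01 => t0 t1.
have -> : kap = theta * (2 - theta) by rewrite /kap; ring.
by rewrite mulr_gt0// subr_gt0; lra.
Qed.

Let z0 : 0 < z. Proof. by rewrite z_def; move: c0 w_ge; lra. Qed.
Let zW0 : 0 < z * W. Proof. exact: mulr_gt0. Qed.
Let WW0 : 0 < W ^+ 2. Proof. exact: exprn_gt0. Qed.
Let c20 : 0 < c ^+ 2. Proof. exact: exprn_gt0. Qed.
Let cW2 : 49 * c ^+ 2 <= W ^+ 2.
Proof.
have : (7 * c) ^+ 2 <= W ^+ 2 by move: c0 W0 cW => *; rewrite ler_pXn2r// ?nnegrE; lra.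
by rewrite exprMn; lra.
Qed.

Let M0 : 0 < M.
Proof. by rewrite addr_gt0// mulr_gt0//; lra. Qed.

Let Y0 : 0 < Y.
Proof. by rewrite addr_gt0// mulr_gt0//; lra. Qed.

Let D0 t : 0 <= D t.
Proof.
have L0 : 0 < c ^+ 2 / h by rewrite divr_gt0.
by rewrite !addr_ge0 ?mulr_ge0 ?sqr_ge0// ?invr_ge0 ltW.
Qed.

(** Cauchy-Schwarz with the weights of D; the summands 16/7 z W, 2 W^2 and 50/49 W^2 of M bound the
    three coefficients. *)
Let G_sqr t : G t ^+ 2 <= M / h * D t.
Proof.
have L0 : 0 < c ^+ 2 / h by rewrite divr_gt0.
have := cauchy_schwarz3 (w + c) (c ^+ 2 / h * (4 - 2 * theta)) (c ^+ 2 / h * 5)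
  (x t) (u t) (v t) (divr_gt0 h0 (ltr0Sn R 1)) (mulr_gt0 L0 kap0)
  (divr_gt0 L0 (ltr0Sn R 1)).
rewrite -/(D t) => CS.
have : G t ^+ 2 <= ((w + c) * x t + c ^+ 2 / h * (4 - 2 * theta) * u t
    + c ^+ 2 / h * 5 * v t) ^+ 2.
  rewrite ler_pXn2r ?nnegrE//.
    by apply: le_trans (G_le t) _; rewrite le_eqVlt; apply/orP; left; apply/eqP; ring.
  by apply: le_trans (G0 t) _; apply: le_trans (G_le t) _;
     rewrite le_eqVlt; apply/orP; left; apply/eqP; ring.
move/le_trans; apply; apply: (le_trans CS); apply: ler_wpM2r => //.
have -> : (w + c) ^+ 2 / (h / 2)
    + (c ^+ 2 / h * (4 - 2 * theta)) ^+ 2 / (c ^+ 2 / h * kap)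
    + (c ^+ 2 / h * 5) ^+ 2 / (c ^+ 2 / h / 2)
    = (2 * (w + c) ^+ 2 + c ^+ 2 * (4 - 2 * theta) ^+ 2 / kap + 50 * c ^+ 2) / h.
  by field; rewrite !gt_eqF.
rewrite ler_pM2r ?invr_gt0// /M.
(* w + c is at most z and, since 7 c <= W, at most 8/7 W. *)
have b1 : 2 * (w + c) ^+ 2 <= 16 / 7 * (z * W).
  have : (w + c) * (w + c) <= z * (8 / 7 * W).
    by move: c0 w_ge wW cW => *; rewrite ler_pM// ?z_def; lra.
  by rewrite expr2; lra.
(* [thetaW] applies because 4 - 2 theta <= 7 - 5 theta for theta < 1. *)
have b2 : c ^+ 2 * (4 - 2 * theta) ^+ 2 / kap <= 2 * W ^+ 2.
  rewrite ler_pdivrMr// [leRHS]mulrAC; apply: le_trans thetaW.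
  rewrite mulrC ler_wpM2r ?sqr_ge0//.
  by case/andP: theta01 => ? ?; rewrite ler_pXn2r// ?nnegrE; lra.
have b3 : 50 * c ^+ 2 <= 50 / 49 * W ^+ 2 by move: cW2; lra.
lra.
Qed.

Let small t := [/\ x t <= eps / (6 * z),
  u t <= h * eps / (60 * (1 - theta) * c ^+ 2)
  & v t <= h * eps / (42 * c ^+ 2)].

(** The quantity beyond its threshold makes its own term of D large: 114 >= 72 * 11/7 serves x, 147
    >= 2 * 3600 / 49 serves u, and 147 >= 3528 / 49 serves v. *)
Let D_large t : ~ small t -> h * eps ^+ 2 <= Y * D t.
Proof.
have heps : 0 <= h * eps ^+ 2 by rewrite mulr_ge0 ?sqr_ge0// ltW.
have th1 : 0 < 1 - theta by case/andP: theta01; lra.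
have L0 : 0 < c ^+ 2 / h by rewrite divr_gt0.
have p1 : 0 <= h / 2 * x t ^+ 2.
  by rewrite mulr_ge0 ?sqr_ge0// ltW// divr_gt0.
have p2 : 0 <= c ^+ 2 / h * kap * u t ^+ 2.
  by rewrite mulr_ge0 ?sqr_ge0// ltW// mulr_gt0.
have p3 : 0 <= c ^+ 2 / h / 2 * v t ^+ 2.
  by rewrite mulr_ge0 ?sqr_ge0// ltW// divr_gt0.
have Dx : h / 2 * x t ^+ 2 <= D t by rewrite /D -addrA lerDl addr_ge0.
have Du : c ^+ 2 / h * kap * u t ^+ 2 <= D t.
  by rewrite /D -addrA addrCA lerDl addr_ge0.
have Dv : c ^+ 2 / h / 2 * v t ^+ 2 <= D t by rewrite /D lerDr addr_ge0.
have sq (r s : R) : 0 < r -> r < s -> r ^+ 2 <= s ^+ 2.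
  by move=> r0 rs; rewrite ler_pXn2r// ?nnegrE; lra.
have key (d k r s : R) : 0 <= k -> k * s ^+ 2 <= d -> 0 < r -> r < s ->
    h * eps ^+ 2 <= Y * (k * r ^+ 2) -> h * eps ^+ 2 <= Y * d.
  move=> k0 kd r0 rs /le_trans; apply; rewrite ler_pM2l//.
  by apply: le_trans kd; rewrite ler_wpM2l// sq.
move=> H; have [xs|xl] := leP (x t) (eps / (6 * z)); last first.
  apply: (key _ (h / 2) _ _ (ltW (divr_gt0 h0 (ltr0Sn R 1))) Dx _ xl).
    by rewrite divr_gt0// mulr_gt0.
  have -> : Y * (h / 2 * (eps / (6 * z)) ^+ 2) = h * eps ^+ 2 * (Y / (72 * z ^+ 2)).
    by field; rewrite gt_eqF.
  rewrite ler_peMr// ler_pdivlMr ?mulr_gt0 ?exprn_gt0// mul1r.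
  have : z * z <= z * (11 / 7 * W) by rewrite ler_pM2l// z_def; move: wW cW; lra.
  by move: zW0 WW0; rewrite /Y expr2; lra.
have [us|ul] := leP (u t) (h * eps / (60 * (1 - theta) * c ^+ 2)); last first.
  apply: (key _ (c ^+ 2 / h * kap) _ _ (ltW (mulr_gt0 L0 kap0)) Du _ ul).
    by rewrite divr_gt0 ?mulr_gt0.
  have -> : Y * (c ^+ 2 / h * kap * (h * eps / (60 * (1 - theta) * c ^+ 2)) ^+ 2)
     = h * eps ^+ 2 * (Y * kap / (3600 * ((1 - theta) ^+ 2 * c ^+ 2))).
    by field; rewrite !gt_eqF.
  rewrite -[leLHS]mulr1; apply: ler_wpM2l; first exact: heps.
  have den0 : 0 < (1 - theta) ^+ 2 * c ^+ 2 by rewrite mulr_gt0 ?exprn_gt0.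
  rewrite ler_pdivlMr; last by rewrite pmulr_lgt0 ?ltr0n.
  rewrite mul1r.
  (* [thetaW] again, now through 7 (1 - theta) <= 7 - 5 theta. *)
  have h1 : 49 * ((1 - theta) ^+ 2 * c ^+ 2) <= 2 * (kap * W ^+ 2).
    rewrite (mulrA 2); apply: le_trans thetaW.
    have -> : 49 * ((1 - theta) ^+ 2 * c ^+ 2) = (7 * (1 - theta)) ^+ 2 * c ^+ 2.
      by ring.
    rewrite ler_wpM2r ?sqr_ge0//.
    by case/andP: theta01 => ? ?; rewrite ler_pXn2r// ?nnegrE; lra.
  have h2 : 0 <= kap * (z * W) by rewrite mulr_ge0// ltW.
  rewrite /Y [leRHS]mulrC mulrDr.
  move: h1 h2 den0; move: ((1 - theta) ^+ 2 * c ^+ 2) => A.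
  by rewrite [kap * (114 * _)]mulrCA [kap * (147 * _)]mulrCA; lra.
have [vs|vl] := leP (v t) (h * eps / (42 * c ^+ 2)); first by exfalso; exact: H.
apply: (key _ (c ^+ 2 / h / 2) _ _ (ltW (divr_gt0 L0 (ltr0Sn R 1))) Dv _ vl).
  by rewrite divr_gt0 ?mulr_gt0.
have -> : Y * (c ^+ 2 / h / 2 * (h * eps / (42 * c ^+ 2)) ^+ 2)
     = h * eps ^+ 2 * (Y / (3528 * c ^+ 2)).
  by field; rewrite !gt_eqF.
rewrite -[leLHS]mulr1; apply: ler_wpM2l; first exact: heps.
rewrite ler_pdivlMr; last by rewrite pmulr_lgt0 ?ltr0n.
by rewrite mul1r /Y; move: c20 cW2 zW0; lra.
Qed.

(** Two phases: by [quadratic_decrease], about 6 M / (h eps) iterations bring G down to eps / 6;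
    then about Y / (6 h eps) iterations without a small one would bring G below 0. Rounding both
    counts up gives the 2. *)
Lemma small_iteration : exists2 t : nat,
  t.+1%:R <= 2 + 48 * (z * W) / (h * eps) + 48 * W ^+ 2 / (h * eps) & small t.
Proof.
have Mh0 : 0 < M / h by rewrite divr_gt0.
have heps : 0 < h * eps by rewrite mulr_gt0.
pose k1 := 6 * (M / h) / eps; pose k2 := Y / (6 * (h * eps)).
have k10 : 0 <= k1 by rewrite !mulr_ge0 ?invr_ge0// ltW.
have k20 : 0 <= k2 by rewrite !mulr_ge0 ?invr_ge0// ltW// mulr_gt0.
pose m1 := (Num.truncn k1).+1; pose m2 := (Num.truncn k2).+1.
have /andP[m1l m1u] := truncn_itv k10; have /andP[m2l m2u] := truncn_itv k20.
apply: contrapT => H.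
have nsmall t : (t < m1 + m2)%N -> ~ small t.
  move=> tm st; apply: H; exists t => //.
  apply: (@le_trans _ _ (m1 + m2)%:R); first by rewrite ler_nat.
  rewrite natrD /m1 /m2 -!natr1.
  have E : k1 + k2 = (6 * M + Y / 6) / (h * eps).
    by rewrite /k1 /k2; field; rewrite !gt_eqF.
  have : (6 * M + Y / 6) / (h * eps) <= (48 * (z * W) + 48 * W ^+ 2) / (h * eps).
    by rewrite ler_pM2r ?invr_gt0// /M /Y; move: zW0 WW0; lra.
  rewrite mulrDl; lra.
have Gm1 : G m1 <= eps / 6.
  have := quadratic_decrease Mh0 G0 GD G_sqr m1.
  have : k1 * G m1 <= m1%:R * G m1 by rewrite ler_wpM2r// ltW.
  move=> /le_trans/[apply]; rewrite /k1 mulrAC ler_pdivrMr// mulrAC mulrC ler_pM2l//.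
  lra.
pose q := h * eps ^+ 2 / Y.
have q0 : 0 < q by rewrite divr_gt0// mulr_gt0// exprn_gt0.
have Gi i : (i <= m2)%N -> G (m1 + i)%N <= eps / 6 - i%:R * q.
  elim: i => [|i IH] im; first by rewrite addn0 mul0r subr0.
  rewrite addnS; apply: le_trans (GD _) _; rewrite -[i.+1%:R]natr1 mulrDl mul1r.
  have /D_large : ~ small (m1 + i) by apply: nsmall; rewrite ltn_add2l.
  rewrite [X in _ <= X]mulrC -ler_pdivrMr// -/q.
  by have := IH (ltnW im); lra.
have : eps / 6 < m2%:R * q.
  apply: le_lt_trans (_ : k2 * q < _); last by rewrite ltr_pM2r.
  by rewrite /k2 /q le_eqVlt; apply/orP; left; apply/eqP; field; rewrite !gt_eqF.
have := Gi m2 (leqnn _); have := G0 (m1 + m2)%N; lra.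
Qed.

End Rate.

(** * The step size, and positivity of the row masses *)

Section StepSize.
Context {R : realType} {n N : nat}.
Hypotheses (n0 : (0 < n)%N) (N0 : (0 < N)%N).
Variables (eps : R) (C : 'I_N -> 'M[R]_n).
Hypotheses (eps0 : 0 < eps) (c0 : 0 < cinf C).

Lemma ln_cells_ge0 : 0 <= ln (n ^ 2 * N)%:R :> R.
Proof. by rewrite ln_ge0// ler1n muln_gt0 expn_gt0 n0. Qed.

Lemma eta_den_gt0 : 0 < 3 * (ln (n ^ 2 * N)%:R + 1) :> R.
Proof. by rewrite mulr_gt0// ltr_wpDl// ln_cells_ge0. Qed.

Lemma eta_gt0 : 0 < eta eps C.
Proof. by rewrite lt_min c0 divr_gt0// eta_den_gt0. Qed.

Lemma eta_le_cinf : eta eps C <= cinf C.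
Proof. by rewrite ge_min lexx orbT. Qed.

Lemma eta_entropy_le : eta eps C * ln (n ^ 2 * N)%:R <= eps / 3.
Proof.
have l0 := ln_cells_ge0; have d0 := eta_den_gt0.
apply: (@le_trans _ _ (eps / (3 * (ln (n ^ 2 * N)%:R + 1)) * ln (n ^ 2 * N)%:R)).
  by rewrite ler_wpM2r// ge_min lexx.
move: l0 d0; set m := ln _ => l0 d0.
rewrite mulrAC ler_pdivrMr// mulrAC ler_pdivlMr//.
have := mulr_ge0 (ltW eps0) l0; have := eps0; lra.
Qed.

(* Lowering the potential of a massless row strictly increases the dual
   objective, so that a maximizer only exists when all row masses are positive. *)
Lemma dual_maximizer_row_gt0 (a b : 'cV[R]_n) fs gs ls : simplex a ->
  dual_maximizer eps a b C fs gs ls -> forall i, 0 < a i 0.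
Proof.
move=> sa [sls Fmax] i; rewrite lt_neqAle sa.1 andbT; apply/eqP => ai.
pose f' := fs - delta_mx i 0.
have := Fmax f' gs ls sls; apply/negP; rewrite -ltNge.
have := dualF_le a b n0 N0 eta_gt0 f' gs ls fs gs ls.
have E : \sum_m (fs m 0 - f' m 0)
    * (a m 0 - rsum (\sum_k gibbs eps C f' gs ls k) m 0)
    = - rsum (\sum_k gibbs eps C f' gs ls k) i 0.
  move: (rsum _) => r; rewrite (bigD1 i)//= big1 => [|m mi].
    by rewrite /f' !mxE !eqxx -ai /=; ring.
  by rewrite /f' !mxE (negbTE mi) /=; ring.
rewrite E.
rewrite [X in _ + X + _ - _]big1 => [|m _]; last by rewrite subrr mul0r.
rewrite [X in _ + X - _]big1 => [|m _]; last by rewrite subrr mul0r.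
have r0 : 0 < rsum (\sum_k gibbs eps C f' gs ls k) i 0.
  pose u0 := (Ordinal N0, Ordinal n0, Ordinal n0).
  have p0 k j : 0 < gibbs eps C f' gs ls k i j.
    by rewrite gibbsE//; exact: softmax_gt0 u0 _ _.
  rewrite rsumE (bigD1 (Ordinal n0))//= ltr_pwDl//.
    rewrite summxE (bigD1 (Ordinal N0))//= ltr_pwDl// sumr_ge0// => k _.
    exact/ltW.
  by rewrite sumr_ge0// => j _; rewrite summxE sumr_ge0// => k _; exact/ltW.
move/le_lt_trans; apply.
set t := (\sum_u `| _ |); have : 0 <= eta eps C / 2 * t ^+ 2.
  by rewrite mulr_ge0 ?sqr_ge0// divr_ge0// ltW// eta_gt0.
by move: r0; lra.
Qed.

End StepSize.

(** * The potential along the iterates and the iteration count *)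

Section Convergence.
Context {R : realType} {n N : nat}.
Variables (eps theta : R) (a b : 'cV[R]_n) (C : 'I_N -> 'M[R]_n).
Variables (fs gs : 'cV[R]_n) (ls : 'cV[R]_N).
Hypotheses (n0 : (0 < n)%N) (N0 : (0 < N)%N).
Hypotheses (eps0 : 0 < eps) (c0 : 0 < cinf C) (theta01 : 0 < theta < 1).
Hypotheses (sa : simplex a) (sb : simplex b) (b0 : forall j, 0 < b j 0).
Hypothesis Fmax : dual_maximizer eps a b C fs gs ls.
Local Notation eta := (eta eps C).
Local Notation cinf := (cinf C).
Local Notation pame := (pame eps theta a b C).
Local Notation pame_f := (pame_f eps theta a b C).
Local Notation pame_g := (pame_g eps theta a b C).
Local Notation pame_lam := (pame_lam eps theta a b C).
Local Notation F := (dualF eps a b C).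
Local Notation w := (2 * cinf - eta * iota_b b).
Local Notation z := (6 * cinf - eta * iota_b b).
Local Notation W := (Num.sqrt (gamma1 eps theta b C))^-1.

Let eta0 : 0 < eta := eta_gt0 n0 N0 eps0 c0.
Let etac : eta <= cinf := eta_le_cinf eps C.
(** The logarithm in the row update asks for positive row masses; the existence of a dual maximizer
    provides them. *)
Let a0 : forall i, 0 < a i 0 := dual_maximizer_row_gt0 n0 N0 eps0 c0 sa Fmax.

Let iota0 : eta * iota_b b <= 0.
Proof. by rewrite mulr_ge0_le0 ?iota_b_le0// ltW. Qed.

Lemma pame_fS t :
  pame_f t.+1 = row_update eps a C (pame_f t) (pame_g t) (pame_lam t).
Proof. by []. Qed.

Lemma pame_gS t :
  pame_g t.+1 = col_update eps b C (pame_f t.+1) (pame_g t) (pame_lam t).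
Proof. by []. Qed.

Lemma pame_lamS t : pame_lam t.+1 = proj_simplex (extrapolate theta (pame t)
  + tau eps C *: gradient (F (pame_f t.+1) (pame_g t.+1))
                   (extrapolate theta (pame t))).
Proof. by []. Qed.

Lemma pame_lam_simplex t :
  simplex (pame_lam t) /\ simplex (st_lam_prev (pame t)).
Proof.
have s0 : simplex (const_mx N%:R^-1 : 'cV[R]_N).
  split=> [i|]; first by rewrite mxE invr_ge0.
  under eq_bigr do rewrite mxE.
  by rewrite sumr_const card_ord -[LHS]mulr_natr mulVf// pnatr_eq0 -lt0n.
elim: t => [|t [IH _]]; first by [].
by split=> //; exact: (proj_simplexP _ N0).1.
Qed.

Lemma pame_row_fit t :
  rsum (\sum_k zeta eps C (pame_f t.+1) (pame_g t) (pame_lam t) k) = a.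
Proof. by rewrite pame_fS; exact: rsum_row_update. Qed.

(** The initial potential is constant, and every later one comes from a column update, after which
    the column sums are exactly b. *)
Lemma pame_g_osc t j j' : pame_g t j 0 - pame_g t j' 0 <= w.
Proof.
case: t => [|t].
  by rewrite !mxE subrr; have := c0; move: iota0; lra.
have cfit : csum (\sum_k zeta eps C (pame_f t.+1) (pame_g t.+1) (pame_lam t) k) = b.
  by rewrite pame_gS; exact: csum_col_update.
exact: col_potential_osc cfit (pame_lam_simplex t).1.
Qed.

(** Index t belongs to the iteration S = t + 1 of the stopping test. *)
Let x t := l1norm (csum (\sum_k pame_plan eps theta a b C t.+1 k) - b).
Let u t := l2norm (pame_lam t - st_lam_prev (pame t)).
Let v t := l2norm (pame_lam t.+1 - extrapolate theta (pame t)).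
Let G t := F fs gs ls - F (pame_f t.+1) (pame_g t) (pame_lam t)
  + cinf ^+ 2 / eta * u t ^+ 2.

Lemma potential_ge0 t : 0 <= G t.
Proof.
rewrite addr_ge0//.
  by rewrite subr_ge0; apply: Fmax.2; exact: (pame_lam_simplex t).1.
by rewrite mulr_ge0 ?sqr_ge0// divr_ge0 ?sqr_ge0// ltW.
Qed.

(** [pame_descent] followed by the row update of the next iteration, which cannot lower the dual
    objective. *)
Lemma potential_decrease t : G t.+1 <= G t - (eta / 2 * x t ^+ 2
  + cinf ^+ 2 / eta * (2 * theta - theta ^+ 2) * u t ^+ 2
  + cinf ^+ 2 / eta / 2 * v t ^+ 2).
Proof.
have [sl slp] := pame_lam_simplex t.
have row : F (pame_f t.+1) (pame_g t.+1) (pame_lam t.+1)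
    <= F (pame_f t.+2) (pame_g t.+1) (pame_lam t.+1).
  by rewrite (pame_fS t.+1); exact: dualF_row_update.
have := pame_descent n0 N0 eta0 etac theta01 sa sb b0 sl (pame_row_fit t)
  (pame_gS t) (erefl (extrapolate theta (pame t)))
  (pame_lamS t) (erefl (x t)) (erefl (u t)) (erefl (v t)).
rewrite /G -/(u t.+1).
move: row.
move: (F _ _ _) (F _ _ _) (F _ _ _) (F _ _ _) (u t.+1 ^+ 2) (x t ^+ 2)
  (u t ^+ 2) (v t ^+ 2) => *; lra.
Qed.

Lemma potential_le t : G t <= (w + cinf) * x t
  + cinf ^+ 2 / eta * ((4 - 2 * theta) * u t + 5 * v t).
Proof.
have [sl slp] := pame_lam_simplex t.
exact: (dual_gap_le n0 N0 eta0 etac theta01 sa sb b0 sl slp (pame_row_fit t)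
  (pame_gS t) (erefl (extrapolate theta (pame t)))
  (pame_lamS t) (erefl (x t)) (erefl (u t)) (erefl (v t))
  (pame_g_osc t) (erefl w) Fmax).
Qed.

Let th1 : 0 < 1 - theta. Proof. by case/andP: theta01; lra. Qed.
Let kap0 : 0 < 2 * theta - theta ^+ 2.
Proof.
case/andP: theta01 => t0 t1.
have -> : 2 * theta - theta ^+ 2 = theta * (2 - theta) by ring.
by rewrite mulr_gt0// subr_gt0; lra.
Qed.
Let th7 : 0 < 7 - 5 * theta. Proof. by move: th1; lra. Qed.
Let w0 : 0 < w. Proof. by move: c0 iota0; lra. Qed.
Let z0 : 0 < z. Proof. by move: c0 iota0; lra. Qed.

Lemma gamma1_gt0 : 0 < gamma1 eps theta b C.
Proof.
rewrite !lt_min; apply/and3P; split.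
- by rewrite divr_gt0// exprn_gt0.
- by rewrite divr_gt0 ?mulr_gt0 ?exprn_gt0.
- by rewrite divr_gt0 ?mulr_gt0 ?exprn_gt0.
Qed.

Let W0 : 0 < W. Proof. by rewrite invr_gt0 sqrtr_gt0 gamma1_gt0. Qed.
Let W2 : W ^+ 2 = (gamma1 eps theta b C)^-1.
Proof. by rewrite exprVn sqr_sqrtr// ltW// gamma1_gt0. Qed.

(** This turns each term of the minimum [gamma1] into a lower bound on W^2, as [small_iteration]
    requires. *)
Let inv_le (s : R) : 0 < s -> gamma1 eps theta b C <= 1 / s -> s <= W ^+ 2.
Proof.
move=> s0; rewrite W2 ler_pdivlMr// mulrC -ler_pdivlMr ?gamma1_gt0//.
by rewrite mul1r.
Qed.

(** With h = eta and W = gamma1^(-1/2) in [small_iteration], 48 z W / (eta eps) and 48 W^2 / (eta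
    eps) are two summands of [iter_bound], and the other two add up to more than 2. *)
Lemma stop_iteration : exists2 t : nat,
  t.+1%:R <= iter_bound eps theta b C eps
  & [/\ x t <= eps / (6 * z), u t <= eta * eps / (60 * (1 - theta) * cinf ^+ 2)
      & v t <= eta * eps / (42 * cinf ^+ 2)].
Proof.
have wW : w <= W.
  rewrite -(ler_pXn2r (n := 2))// ?nnegrE ?(ltW w0) ?(ltW W0)//.
  by apply: inv_le; [exact: exprn_gt0|rewrite ge_min lexx].
have cW : 7 * cinf <= W.
  rewrite -(ler_pXn2r (n := 2))// ?nnegrE ?(ltW W0) ?mulr_ge0 ?(ltW c0)//.
  apply: inv_le; first by rewrite exprn_gt0// mulr_gt0.
  have -> : (7 * cinf) ^+ 2 = 49 * cinf ^+ 2 by ring.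
  by rewrite !ge_min lexx !orbT.
have thW : (7 - 5 * theta) ^+ 2 * cinf ^+ 2
    <= 2 * (2 * theta - theta ^+ 2) * W ^+ 2.
  have k2 : 0 < 2 * (2 * theta - theta ^+ 2) by rewrite mulr_gt0.
  have e0 : 0 < (7 - 5 * theta) ^+ 2 * cinf ^+ 2 by rewrite mulr_gt0 ?exprn_gt0.
  rewrite [leRHS]mulrC -ler_pdivrMr//; apply: inv_le; first by rewrite divr_gt0.
  rewrite div1r invf_div.
  by rewrite !ge_min lexx orbT.
have wc : 2 * cinf <= w by move: iota0; lra.
have zE : z = w + 4 * cinf by ring.
have xs0 t : 0 <= x t by rewrite /x l1norm_cV sumr_ge0.
have [t tT small] := small_iteration eps0 theta01 eta0 c0 wc zE W0 wW cW thW
  xs0 (fun t => l2norm_ge0 _) (fun t => l2norm_ge0 _)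
  potential_ge0 potential_decrease potential_le.
exists t => //; apply: (le_trans tT).
have g0 := gamma1_gt0.
rewrite /iter_bound /eps' W2 -[_ * eps in X in _ <= _ + _ + X]mulrA.
have -> : 48 / (eta * Num.sqrt (gamma1 eps theta b C) * (eps / z))
    = 48 * (z * W) / (eta * eps).
  by field; rewrite !gt_eqF// sqrtr_gt0.
have -> : 48 / (eta * (gamma1 eps theta b C * eps))
    = 48 * (gamma1 eps theta b C)^-1 / (eta * eps).
  by field; rewrite !gt_eqF.
have p3 : 0 <= (3600 * (1 - theta) ^+ 2 + 882) * cinf ^+ 2 * eps
    / (eta * eps ^+ 2).
  apply: divr_ge0; last by rewrite mulr_ge0 ?sqr_ge0// ltW.
  apply: mulr_ge0; last exact: ltW.
  exact: mulr_ge0 (addr_ge0 (mulr_ge0 (ler0n R _) (sqr_ge0 _)) (ler0n R _))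
    (sqr_ge0 _).
move: p3; set p := _ / (eta * eps ^+ 2); lra.
Qed.

Lemma pame_rounded_eps_optimal : exists S : nat,
  [/\ pame_performs eps theta a b C fs gs ls S,
      S%:R <= iter_bound eps theta b C eps
    & rounded_eps_optimal eps a b C
        (pame_plan eps theta a b C S) (pame_lam S.-1)].
Proof.
(* The first iteration meeting the first three conditions of the stopping test
   is performed, as no earlier one passes the whole test. *)
pose small t := `[< [/\ x t <= eps / (6 * z),
  u t <= eta * eps / (60 * (1 - theta) * cinf ^+ 2)
  & v t <= eta * eps / (42 * cinf ^+ 2)] >].
have exs : exists t, small t.
  by have [t _ st] := stop_iteration; exists t; apply/asboolP.
have [t /asboolP [xt ut vt] tmin] := ex_minnP exs.
exists t.+1; split.
- split=> // S /andP[S0 St] [xS uS vS _].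
  have : small S.-1 by apply/asboolP; rewrite /x /v (prednK S0).
  by move/tmin; rewrite leqNgt -ltnS prednK// St.
- have [t' t'T /asboolP/tmin tt'] := stop_iteration.
  by apply: le_trans t'T; rewrite ler_nat ltnS.
- have [sl slp] := pame_lam_simplex t.
  exact: (rounded_gap n0 N0 eta0 etac theta01 sa sb b0 sl (pame_row_fit t)
    (pame_gS t) (erefl (extrapolate theta (pame t)))
    (pame_lamS t) (erefl (x t)) (erefl (u t)) (erefl (v t))
    (pame_g_osc t) (erefl w) (eta_entropy_le n0 N0 C eps0) xt ut vt).
Qed.

End Convergence.

(** * Orders of magnitude of [gamma1] and of the iteration bound *)

Section Rates.
Context {R : realType} {n N : nat}.
Hypotheses (n0 : (0 < n)%N) (N0 : (0 < N)%N).
Variables (theta : R) (b : 'cV[R]_n).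
Hypotheses (theta01 : 0 < theta < 1).

Lemma gamma1_le (eps : R) (C : 'I_N -> 'M[R]_n) : 0 < cinf C ->
  gamma1 eps theta b C <= 49^-1 * (cinf C)^-1 ^+ 2.
Proof.
by move=> c0; rewrite exprVn -invfM -div1r !ge_min lexx !orbT.
Qed.

(** For eps <= cinf the minimum defining [eta] is eps / lam. With 1 / gamma1 <= k cinf^2, every
    summand is then at most a multiple of cinf^2 / eps^2, by a factor depending on n, N, theta and b
    alone. *)
Lemma iter_bound_le : exists K : R, forall (eps : R) (C : 'I_N -> 'M[R]_n),
  0 < eps <= cinf C ->
  iter_bound eps theta b C eps <= K * (cinf C ^+ 2 * eps^-1 ^+ 2).
Proof.
case/andP: theta01 => t0 t1.
pose kap := 2 * theta - theta ^+ 2.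
have kap0 : 0 < kap.
  have -> : kap = theta * (2 - theta) by rewrite /kap; ring.
  by rewrite mulr_gt0// subr_gt0; lra.
have th7 : 0 < 7 - 5 * theta by lra.
pose lam : R := 3 * (ln (n ^ 2 * N)%:R + 1).
have lam0 : 0 < lam by exact: eta_den_gt0.
pose q := - iota_b b.
have q0 : 0 <= q by rewrite oppr_ge0 iota_b_le0.
pose r := (7 - 5 * theta) ^+ 2 / (2 * kap).
have r0 : 0 < r by rewrite divr_gt0 ?exprn_gt0 ?mulr_gt0.
(* In units of c^2, the summands of k bound the reciprocals of the three terms of [gamma1], the
   first through w <= (2 + q) c. As k >= 1, it also bounds its own square root. *)
pose k := (2 + q) ^+ 2 + r + 49.
have k1 : 1 <= k by rewrite /k; have := sqr_ge0 (2 + q); move: r0; lra.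
pose A := 3600 * (1 - theta) ^+ 2 + 882.
have A0 : 0 <= A.
  exact: addr_ge0 (mulr_ge0 (ler0n R _) (sqr_ge0 _)) (ler0n R _).
exists (8 + 48 * lam * (6 + q) * k + A * lam + 48 * lam * k).
move=> eps C /andP[eps0 epsc]; set c := cinf C.
have c0 : 0 < c := lt_le_trans eps0 epsc.
have etaE : eta eps C = eps / lam.
  apply/min_idPl; apply: le_trans epsc.
  rewrite ler_pdivrMr// ler_peMr ?(ltW eps0)// /lam.
  by have := ln_cells_ge0 (R := R) n0 N0; lra.
have eta0 : 0 < eta eps C by exact: eta_gt0.
have etac : eta eps C <= c by exact: eta_le_cinf.
have hq : 0 <= eta eps C * q <= c * q.
  by rewrite mulr_ge0 ?(ltW eta0)//= ler_wpM2r.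
pose w := 2 * c - eta eps C * iota_b b; pose z := 6 * c - eta eps C * iota_b b.
have wE : w = 2 * c + eta eps C * q by rewrite /w /q; ring.
have zE : z = 6 * c + eta eps C * q by rewrite /z /q; ring.
have w0 : 0 < w by rewrite wE; case/andP: hq => h1 _; move: c0; lra.
have z0 : 0 < z by rewrite zE; case/andP: hq => h1 _; move: c0; lra.
have zle : z <= (6 + q) * c by rewrite zE; case/andP: hq => _ h1; lra.
have kc0 : 0 < k * c ^+ 2 by rewrite mulr_gt0 ?exprn_gt0//; lra.
have g_ge : (k * c ^+ 2)^-1 <= gamma1 eps theta b C.
  have inv (s : R) : 0 < s -> s <= k * c ^+ 2 -> (k * c ^+ 2)^-1 <= 1 / s.
    by move=> s0 sk; rewrite div1r lef_pV2.
  rewrite !le_min -/c -/kap; apply/and3P; split.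
  - apply: inv; first exact: exprn_gt0.
    apply: (@le_trans _ _ (((2 + q) * c) ^+ 2)).
      rewrite ler_pXn2r ?nnegrE ?(ltW w0)//.
        by rewrite -/w wE; case/andP: hq => _ h1; lra.
      by rewrite mulr_ge0 ?(ltW c0)// addr_ge0.
    by rewrite exprMn ler_wpM2r ?sqr_ge0// /k; move: r0; lra.
  - have -> : 2 * kap / ((7 - 5 * theta) ^+ 2 * c ^+ 2) = 1 / (r * c ^+ 2).
      by rewrite /r; field; rewrite !gt_eqF.
    apply: inv; first by rewrite mulr_gt0 ?exprn_gt0.
    by rewrite ler_wpM2r ?sqr_ge0// /k; have := sqr_ge0 (2 + q); lra.
  - apply: inv; first by rewrite mulr_gt0 ?exprn_gt0.
    by rewrite ler_wpM2r ?sqr_ge0// /k; have := sqr_ge0 (2 + q); move: r0; lra.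
have kc1 : 0 < k * c by rewrite mulr_gt0//; lra.
have g0 : 0 < gamma1 eps theta b C by apply: lt_le_trans g_ge; rewrite invr_gt0.
have sg_ge : (k * c)^-1 <= Num.sqrt (gamma1 eps theta b C).
  rewrite -(ler_pXn2r (n := 2))// ?nnegrE ?invr_ge0 ?(ltW kc1) ?sqrtr_ge0//.
  rewrite sqr_sqrtr ?(ltW g0)//; apply: le_trans g_ge.
  rewrite exprVn lef_pV2 ?posrE ?exprn_gt0// exprMn ler_wpM2r ?sqr_ge0//.
  by rewrite expr2 ler_peMr//; lra.
have ginv : (gamma1 eps theta b C)^-1 <= k * c ^+ 2.
  by rewrite -[leRHS]invrK lef_pV2 ?posrE ?invr_gt0.
have sg0 : 0 < Num.sqrt (gamma1 eps theta b C) by rewrite sqrtr_gt0.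
have sginv : (Num.sqrt (gamma1 eps theta b C))^-1 <= k * c.
  by rewrite -[leRHS]invrK lef_pV2 ?posrE ?invr_gt0.
pose X := c ^+ 2 * eps^-1 ^+ 2.
have e2 : 0 < eps^-1 ^+ 2 by rewrite exprn_gt0 ?invr_gt0.
(* This absorbs the additive constant 8. *)
have X1 : 1 <= X.
  by rewrite /X exprVn ler_pdivlMr ?exprn_gt0// mul1r ler_pXn2r// ?nnegrE ltW.
rewrite /iter_bound /eps' -/c -/z -/A -/X etaE.
have T1 : 48 / (eps / lam * Num.sqrt (gamma1 eps theta b C) * (eps / z))
    <= 48 * lam * (6 + q) * k * X.
  have -> : 48 / (eps / lam * Num.sqrt (gamma1 eps theta b C) * (eps / z))
    = (48 * lam) * eps^-1 ^+ 2 * (z * (Num.sqrt (gamma1 eps theta b C))^-1).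
    by field; rewrite !gt_eqF.
  have -> : 48 * lam * (6 + q) * k * X
    = (48 * lam) * eps^-1 ^+ 2 * (((6 + q) * c) * (k * c)).
    by rewrite /X; ring.
  apply: ler_wpM2l; first by rewrite mulr_ge0 ?(ltW e2)// mulr_ge0 ?ler0n// ltW.
  by rewrite ler_pM// ?invr_ge0 ltW.
have T2 : A * c ^+ 2 * eps / (eps / lam * eps ^+ 2) = A * lam * X.
  by rewrite /X; field; rewrite !gt_eqF.
have T3 : 48 / (eps / lam * gamma1 eps theta b C * eps) <= 48 * lam * k * X.
  have -> : 48 / (eps / lam * gamma1 eps theta b C * eps)
    = 48 * lam * eps^-1 ^+ 2 * (gamma1 eps theta b C)^-1.
    by field; rewrite !gt_eqF.
  have -> : 48 * lam * k * X = 48 * lam * eps^-1 ^+ 2 * (k * c ^+ 2).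
    by rewrite /X; ring.
  by apply: ler_wpM2l => //; rewrite mulr_ge0 ?(ltW e2)// mulr_ge0 ?ler0n// ltW.
have sum_le (s1 s2 s3 k1' k2 k3 : R) : s1 <= k1' * X -> s2 = k2 * X ->
    s3 <= k3 * X -> 8 + s1 + s2 + s3 <= (8 + k1' + k2 + k3) * X.
  by move: X1; lra.
exact: sum_le T1 T2 T3.
Qed.

End Rates.

Theorem theorem18 (R : realType) (n N : nat) (theta : R) (b : 'cV[R]_n)
    (hn : (1 <= n)%N) (hN : (1 <= N)%N) (htheta : 0 < theta < 1)
    (hb : simplex b) (hbpos : forall j, 0 < b j 0) :
  [/\ forall (eps : R) (a : 'cV[R]_n) (C : 'I_N -> 'M[R]_n)
             (fs gs : 'cV[R]_n) (ls : 'cV[R]_N),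
        0 < eps -> 0 < cinf C -> simplex a ->
        dual_maximizer eps a b C fs gs ls ->
        exists S : nat,
          [/\ pame_performs eps theta a b C fs gs ls S,
              S%:R <= iter_bound eps theta b C eps
            & rounded_eps_optimal eps a b C
                (pame_plan eps theta a b C S) (pame_lam eps theta a b C S.-1)],
      exists K : R, forall (eps : R) (C : 'I_N -> 'M[R]_n),
        0 < eps -> 0 < cinf C ->
        gamma1 eps theta b C <= K * (cinf C)^-1 ^+ 2
    & exists K : R, forall (eps : R) (C : 'I_N -> 'M[R]_n),
        0 < eps <= cinf C ->
        iter_bound eps theta b C eps <= K * (cinf C ^+ 2 * eps^-1 ^+ 2)].
Proof.
split=> [eps a C fs gs ls eps0 c0 sa Fmax||].
- exact: pame_rounded_eps_optimal.
- by exists 49^-1 => eps C _; exact: gamma1_le.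
- exact: iter_bound_le.
Qed.
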